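(* Let $\epsilon \in (0,1)$. There is a multi-party communication protocol in the message passing model (on any connected graph $G$ with $m$ vertices, player $i$ holding $X_i \in \{0,1,\dots,M\}^n$, $\mathcal{X}=\sum_i X_i$) that outputs an $\epsilon$-additive approximation $\tilde{H}$ of the Shannon entropy $H$ of $\mathcal{X}$, i.e. $|\tilde{H}-H|\le \epsilon$. The protocol uses a max communication of $O\!\left(\frac{1}{\epsilon^2}(\log\log n + \log(1/\epsilon))\right)$ bits.
   Context: The (empirical) Shannon entropy of a nonzero $\mathcal{X} \in \mathbb{R}^n$ is $H = \sum_{i=1}^n p_i \log(1/p_i)$ where $p_i = |\mathcal{X}_i|/\|\mathcal{X}\|_1$ (terms with $p_i=0$ are $0$). Message passing model: there are $m$ players, one at each vertex of a connected undirected graph $G$ known to all players; player $i$ receives only its input $X_i$; a player may send a message only to a neighbor in $G$, received only by that neighbor; the players share a public random string; at termination a pre-specified player holds the output. Max communication is the maximum number of bits sent across any single edge. Standing assumption: $m, M = O(n^{c})$ for a constant $c$. *)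

(* Defs.v *)
From HB Require Import structures.
From mathcomp Require Import all_boot all_order all_algebra.
From mathcomp Require Import reals exp.

Set Implicit Arguments.
Unset Strict Implicit.
Unset Printing Implicit Defensive.

Import Order.TTheory GRing.Theory Num.Theory.
Local Open Scope ring_scope.

(* Natural logarithm.  Coordinates with p i = 0 contribute 0 because of the
   factor p i.  Only meaningful for x != 0. *)
Definition entropy (R : realType) (n : nat) (x : 'rV[R]_n) : R :=
  let p i := `|x 0 i| / \sum_(j < n) `|x 0 j| in
  \sum_(i < n) p i * ln (1 / p i).

Definition inputs (m n M : nat) := {ffun 'I_m -> {ffun 'I_n -> 'I_M.+1}}.

Definition aggregate (R : realType) (m n M : nat) (X : inputs m n M) : 'rV[R]_n :=
  \row_(j < n) \sum_(u < m) (X u j)%:R.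

(* What one player receives in one round, indexed by the sender; the empty
   string means that nothing was sent. *)
Definition inbox (m : nat) := {ffun 'I_m -> bitseq}.

(* A protocol runs in lockstep rounds.  In each round a player computes its
   outgoing messages from its own input, the public string of [coins] uniform
   bits, and the inboxes of the previous rounds (oldest first).  The arguments
   of [send] are: sender, its input, public string, past inboxes, addressee.
   [decode] is applied by the output player. *)
Record protocol (R : realType) (m n M : nat) := Protocol {
  coins : nat;
  rounds : nat;
  send : 'I_m -> {ffun 'I_n -> 'I_M.+1} -> coins.-tuple bool ->
         seq (inbox m) -> 'I_m -> bitseq;
  decode : {ffun 'I_n -> 'I_M.+1} -> coins.-tuple bool -> seq (inbox m) -> R
}.

Section Execution.
Variables (R : realType) (m n M : nat) (P : protocol R m n M).
Implicit Types (X : inputs m n M) (w : (coins P).-tuple bool) (u v : 'I_m).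

(* The inboxes of player v in the first t rounds. *)
Fixpoint history X w (t : nat) v : seq (inbox m) :=
  if t is t'.+1 then
    rcons (history X w t' v)
          [ffun u => send u (X u) w (history X w t' u) v]
  else [::].

Definition message X w (t : nat) u v : bitseq :=
  send u (X u) w (history X w t u) v.

Definition along_edges (e : rel 'I_m) : Prop :=
  forall X w t u v, (t < rounds P)%N -> ~~ e u v -> message X w t u v = [::].

(* The receiver can tell from its own view where a message ends: given that
   view, the possible messages form a prefix-free set.  In particular a sender
   may stay silent only if the receiver already knows that it will; otherwise
   the common clock would let silence and timing carry uncharged information.
   The length and the presence of messages may still depend on the past. *)
Definition self_delimiting : Prop :=
  forall X X' w t u v, (t < rounds P)%N ->
    X v = X' v -> history X w t v = history X' w t v ->
    prefix (message X w t u v) (message X' w t u v) ->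
    message X w t u v = message X' w t u v.

Definition edge_bits X w u v : nat :=
  (\sum_(t < rounds P) (size (message X w t u v) + size (message X w t v u)))%N.

Definition max_communication (e : rel 'I_m) : nat :=
  (\max_(X : inputs m n M) \max_(w : (coins P).-tuple bool)
     \max_(uv : 'I_m * 'I_m | e uv.1 uv.2) edge_bits X w uv.1 uv.2)%N.

Definition output (o : 'I_m) X w : R :=
  decode (X o) w (history X w (rounds P) o).

Definition success_prob (o : 'I_m) (eps : R) X : R :=
  #|[set w : (coins P).-tuple bool |
      `|output o X w - entropy (aggregate R X)| <= eps]|%:R / 2 ^+ coins P.

End Execution.

(* Main.v *)
Require Import Defs.
From mathcomp Require Import all_boot all_order all_algebra.
From mathcomp Require Import boolp functions reals.
From mathcomp Require Import topology normedtype sequences derive realfun exp.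
From mathcomp Require Import ring lra zify.

Set Implicit Arguments.
Unset Strict Implicit.
Unset Printing Implicit Defensive.

Import Order.TTheory GRing.Theory Num.Theory.
Import numFieldNormedType.Exports.
Local Open Scope ring_scope.

(** Let [p] be the normalised input of total mass [S] and entropy [H].  If [V] is
    a random variable with Laplace transform close to [exp (s ln s)] (a sum of
    [N] independent discrete Pareto variables, a maximally skewed 1-stable law
    in the limit) and [C = \sum_i X_i V_i] with independent copies [V_i], then
    [N exp (- C / (S N))] has mean about [exp (- H)] and second moment about
    [4 exp (- 2 H)].  So the logarithm of an average of [O(1/eps^2)] such
    quantities estimates [- H] up to [eps].

    The counters [S] and [C] are linear in the input.  They are summed up a BFS
    tree in floating point with unbiased random rounding.  When grid points
    [r_1, r_2, ...] are merged into [x = a + r_1 + r_2 + ...], the rounding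
    variance is at most [2^-b (x^2 - r_1^2 - r_2^2 - ...)], because no [r_i]
    exceeds the rounded-down value of [x].  These bounds telescope along the
    tree, so the relative error is [O(2^(-b/2))] whatever its depth, and
    [b = O(ln ln n + ln (1/eps))] bits of mantissa are enough. *)

(** * Partial sums of the logarithmic series *)

Section LogSeries.
Variable R : realType.
Implicit Types (s t x y z : R) (K n : nat).

Lemma geometric_sum z K : (1 - z) * \sum_(j < K) z ^+ j = 1 - z ^+ K.
Proof.
by rewrite -[LHS]opprK -mulNr opprB -subrX1 opprB.
Qed.

Lemma is_derive_log_series K z : z < 1 ->
  is_derive z 1 (fun y => y * (\sum_(j < K) y ^+ j / j.+1%:R) + ln (1 - y))
    (- (z ^+ K / (1 - z))).
Proof.
move=> z1; elim: K => [|K IH].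
  have -> : (fun y => y * (\sum_(j < 0) y ^+ j / j.+1%:R) + ln (1 - y)) =
            (fun y => ln (1 - y)).
    by apply/funext => y; rewrite big_ord0 mulr0 add0r.
  have D : 0 < 1 - z by lra.
  have H := is_derive1_ln D.
  have G : is_derive z 1 (fun y : R => 1 - y) (-1).
    apply: is_derive_eq; lra.
  have := @is_derive1_comp _ (@ln R) (fun y : R => 1 - y) z _ _ H G.
  rewrite /comp => E; apply: is_derive_eq.
  by rewrite expr0; field; lra.
have -> : (fun y => y * (\sum_(j < K.+1) y ^+ j / j.+1%:R) + ln (1 - y)) =
   (fun y => (y * (\sum_(j < K) y ^+ j / j.+1%:R) + ln (1 - y))) \+
   (K.+1%:R^-1 \*: (fun y => y ^+ K.+1)).
  apply/funext => y /=; rewrite big_ord_recr /=.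
  rewrite exprS /GRing.scale /=; ring.
have G : is_derive z 1 (K.+1%:R^-1 \*: (fun y : R => y ^+ K.+1)) (z ^+ K).
  have -> : (fun y : R => y ^+ K.+1) = (id : R -> R) ^+ K.+1.
    by apply/funext => y; elim: K.+1 => [|k IHk] //; rewrite !exprS IHk.
  apply: is_derive_eq; rewrite /= -[_%:A]mulr1 /GRing.scale /=.
  by rewrite -mulr_natl; field; rewrite addrC natr1 pnatr_eq0.
have := @is_deriveD _ _ _ _ _ _ _ _ _ IH G.
move=> E; apply: is_derive_eq.
by rewrite exprS; field; lra.
Qed.

Lemma log_series_bound K z : 0 <= z < 1 ->
  `|z * (\sum_(j < K) z ^+ j / j.+1%:R) + ln (1 - z)| <= z ^+ K / (1 - z).
Proof.
move=> /andP[z0 z1].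
set F := fun y => y * (\sum_(j < K) y ^+ j / j.+1%:R) + ln (1 - y).
have [||c c01] := @MVT_segment R F (fun y => - (y ^+ K / (1 - y))) 0 z z0.
- move=> x /[!in_itv]/andP[_ xz]; apply: is_derive_log_series.
  exact: lt_trans xz z1.
- apply: derivable_within_continuous => x /[!in_itv]/= /andP[_ xz].
  by have [] := @is_derive_log_series K x (le_lt_trans xz z1).
have -> : F 0 = 0 by rewrite /F mul0r subr0 ln1 addr0.
rewrite subr0 /F subr0 => ->.
move: c01; rewrite in_itv /= => /andP[c0 cz].
have c1 : c < 1 by lra.
have c1' : 0 < 1 - c by lra.
have z1' : 0 < 1 - z by lra.
rewrite normrM normrN (ger0_norm z0) (ger0_norm (divr_ge0 (exprn_ge0 _ c0) (ltW c1'))).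
rewrite -[leRHS]mulr1; apply: ler_pM;
  rewrite ?divr_ge0 ?exprn_ge0 ?(ltW c1')//; last exact: ltW.
apply: ler_pM; rewrite ?exprn_ge0 ?invr_ge0 ?(ltW c1')//.
  by rewrite lerXn2r.
by rewrite lef_pV2 ?posrE //; lra.
Qed.
End LogSeries.

(** * Expectation over a finite uniform space *)

Definition Ex (R : realType) (T : finType) (f : T -> R) : R :=
  (\sum_w f w) / #|T|%:R.

Definition Pr (R : realType) (T : finType) (P : pred T) : R :=
  Ex (fun w => (P w)%:R).
Arguments Pr R {T} P.

Section Expectation.
Variables (R : realType) (T : finType).
Implicit Types (f g : T -> R) (P Q : pred T).

Lemma eq_Ex f g : f =1 g -> Ex f = Ex g.
Proof. by move=> fg; rewrite /Ex (eq_bigr g). Qed.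

Lemma le_Ex f g : (forall w, f w <= g w) -> Ex f <= Ex g.
Proof. by move=> fg; rewrite /Ex ler_wpM2r ?invr_ge0 ?ler0n// ler_sum. Qed.

Lemma Ex_ge0 f : (forall w, 0 <= f w) -> 0 <= Ex f.
Proof. by move=> f0; rewrite /Ex divr_ge0 ?ler0n// sumr_ge0. Qed.

Lemma ExD f g : Ex (fun w => f w + g w) = Ex f + Ex g.
Proof. by rewrite /Ex big_split mulrDl. Qed.

Lemma ExZ (k : R) f : Ex (fun w => k * f w) = k * Ex f.
Proof. by rewrite /Ex -mulr_sumr mulrA. Qed.

Lemma Ex_sum (I : finType) (A : pred I) (F : I -> T -> R) :
  Ex (fun w => \sum_(i | A i) F i w) = \sum_(i | A i) Ex (F i).
Proof. by rewrite /Ex exchange_big mulr_suml. Qed.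

Lemma Ex_cst (k : R) : (0 < #|T|)%N -> Ex (fun _ : T => k) = k.
Proof.
move=> T0; rewrite /Ex sumr_const -(mulr_natr k) mulfK//.
by rewrite pnatr_eq0 -lt0n.
Qed.

Lemma ler_Pr P Q : (forall w, P w -> Q w) -> Pr R P <= Pr R Q.
Proof.
move=> PQ; apply: le_Ex => w; case: (boolP (P w)) => [/PQ ->//|_].
by rewrite ler0n.
Qed.

Lemma Pr_or P Q : Pr R (fun w => P w || Q w) <= Pr R P + Pr R Q.
Proof.
rewrite /Pr -ExD; apply: le_Ex => w.
by case: (P w); case: (Q w); rewrite ?addr0 ?add0r //= lerDl ler01.
Qed.

Lemma Pr_exists (I : finType) (P : I -> pred T) :
  Pr R (fun w => [exists i, P i w]) <= \sum_i Pr R (P i).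
Proof.
rewrite -Ex_sum; apply: le_Ex => w.
case: existsP => [[i Pi]|_] /=; last by rewrite sumr_ge0.
by rewrite (bigD1 i) //= Pi lerDl sumr_ge0.
Qed.

Lemma markov f (t : R) : 0 < t -> (forall w, 0 <= f w) ->
  Pr R (fun w => t <= f w) <= Ex f / t.
Proof.
move=> t0 f0; rewrite ler_pdivlMr // mulrC -ExZ; apply: le_Ex => w.
by case: (leP t (f w)) => [|_]; rewrite ?mulr1 ?mulr0.
Qed.

Lemma chebyshev f (mu t : R) : 0 < t ->
  Pr R (fun w => t < `|f w - mu|) <= Ex (fun w => (f w - mu) ^+ 2) / t ^+ 2.
Proof.
move=> t0; apply: le_trans (markov (exprn_gt0 2 t0) _); last first.
  by move=> w; exact: sqr_ge0.
apply: ler_Pr => w tf; rewrite -(real_normK (num_real (f w - mu))).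
by rewrite lerXn2r ?nnegrE ?normr_ge0 ?ltW.
Qed.

Lemma Pr_predC P : (0 < #|T|)%N -> Pr R (predC P) = 1 - Pr R P.
Proof.
move=> T0; apply/eqP; rewrite -subr_eq opprK addrC -ExD -[eqbRHS](Ex_cst 1 T0).
by apply/eqP/eq_Ex => w /=; case: (P w); rewrite ?addr0 ?add0r.
Qed.

Lemma Pr_card P : Pr R P = #|[set w | P w]|%:R / #|T|%:R.
Proof.
rewrite /Pr /Ex -sum1_card natr_sum; congr (_ / _).
by rewrite [RHS]big_mkcond /=; apply: eq_bigr => w _; rewrite inE; case: (P w).
Qed.

End Expectation.

Section Product.
Variable R : realType.

Lemma Ex_pair (A B : finType) (f : A * B -> R) :
  Ex f = Ex (fun a => Ex (fun b => f (a, b))).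
Proof.
rewrite /Ex card_prod natrM invfM mulrA mulrAC.
rewrite -mulr_suml; congr (_ * _ * _).
by rewrite pair_bigA /=; apply: eq_bigr => -[].
Qed.

Variables (I A : finType).
Implicit Types (w : {ffun I -> A}) (i : I) (c : A).

Definition upd w i c : {ffun I -> A} := [ffun j => if j == i then c else w j].

Lemma Ex_resample i (F : {ffun I -> A} -> R) :
  (0 < #|A|)%N -> Ex F = Ex (fun w => Ex (fun c => F (upd w i c))).
Proof.
move=> A0; pose h (p : {ffun I -> A} * A) := (upd p.1 i p.2, p.1 i).
have hK : involutive h.
  move=> [w c]; rewrite /h /=; congr (_, _); last by rewrite ffunE eqxx.
  by apply/ffunP => j; rewrite !ffunE; case: eqP => [->|].
have -> : Ex F = Ex (fun p : {ffun I -> A} * A => F p.1).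
  rewrite Ex_pair /=; apply: eq_Ex => w; rewrite Ex_cst //.
rewrite -(Ex_pair (fun p => F (upd p.1 i p.2))) /Ex.
by rewrite (reindex_inj (inv_inj hK)).
Qed.

Lemma Ex_marginal i (f : A -> R) : (0 < #|A|)%N ->
  Ex (fun w : {ffun I -> A} => f (w i)) = Ex f.
Proof.
move=> A0; rewrite (Ex_resample i) //.
have -> : Ex (fun w => Ex (fun c => f (upd w i c i))) =
          Ex (fun w : {ffun I -> A} => Ex f).
  by apply: eq_Ex => w; apply: eq_Ex => c; rewrite ffunE eqxx.
by rewrite Ex_cst // card_ffun expn_gt0 A0.
Qed.

Lemma Ex_orthogonal i (f g : {ffun I -> A} -> R) : (0 < #|A|)%N ->
  (forall w c, g (upd w i c) = g w) ->
  (forall w, \sum_c f (upd w i c) = 0) ->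
  Ex (fun w => f w * g w) = 0.
Proof.
move=> A0 gi fi; rewrite (Ex_resample i) //.
rewrite -[RHS](@Ex_cst R {ffun I -> A} 0) ?card_ffun ?expn_gt0 ?A0 //.
apply: eq_Ex => w; rewrite /Ex.
under eq_bigr do rewrite gi.
by rewrite -mulr_suml fi !mul0r.
Qed.

Lemma Ex_prod (f : I -> A -> R) :
  Ex (fun w : {ffun I -> A} => \prod_i f i (w i)) = \prod_i Ex (f i).
Proof.
rewrite /Ex -bigA_distr_bigA prodf_div prodr_const card_ffun natrX.
by congr (_ / _ ^+ _).
Qed.

Lemma Ex_mean_sqr (f : A -> R) (mu : R) : (0 < #|A|)%N -> (0 < #|I|)%N ->
  Ex f = mu ->
  Ex (fun w : {ffun I -> A} => ((\sum_i f (w i)) / #|I|%:R - mu) ^+ 2)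
    = Ex (fun c => (f c - mu) ^+ 2) / #|I|%:R.
Proof.
move=> A0 I0 fmu; have kn0 : #|I|%:R != 0 :> R by rewrite pnatr_eq0 -lt0n.
have -> : Ex (fun w : {ffun I -> A} => ((\sum_i f (w i)) / #|I|%:R - mu) ^+ 2) =
   Ex (fun w : {ffun I -> A} => #|I|%:R ^- 2 *
     (\sum_i \sum_j (f (w i) - mu) * (f (w j) - mu))).
  apply: eq_Ex => w; rewrite -[X in _ - X](mulfK kn0) -mulrBl exprMn exprVn mulrC.
  congr (_ * _).
  have -> : \sum_i f (w i) - mu * #|I|%:R = \sum_i (f (w i) - mu).
    by rewrite sumrB sumr_const -[in RHS]mulr_natr.
  by rewrite expr2 big_distrlr.
rewrite ExZ Ex_sum.
have -> : \sum_i Ex (fun w : {ffun I -> A} => \sum_j (f (w i) - mu) * (f (w j) - mu))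
   = \sum_(i : I) Ex (fun c => (f c - mu) ^+ 2).
  apply: eq_bigr => i _; rewrite Ex_sum (bigD1 i) //= [X in _ + X]big1 ?addr0.
    by rewrite -(Ex_marginal i).
  move=> j ji; apply: (@Ex_orthogonal i) => // [w c|w].
    by rewrite ffunE (negPf ji).
  under eq_bigr do rewrite ffunE eqxx.
  rewrite sumrB sumr_const -fmu /Ex -[X in _ - X]mulr_natr divfK ?subrr //.
  by rewrite pnatr_eq0 -lt0n.
rewrite sumr_const -[X in _ * X]mulr_natr expr2 invfM; field => //.
Qed.

End Product.

(** * The discrete Pareto law and the entropy sketch *)

Section Pareto.
Variable R : realType.
Implicit Types (s z : R) (K : nat).

(* For uniform [u], [P (pareto u > j) = floor (K / (j + 1)) / K], which is [1 / (j + 1)]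
   up to [1 / K]. *)
Definition pareto K (u : 'I_K) : nat := (K %/ u.+1)%N.

Lemma pareto_le K (u : 'I_K) : (pareto u <= K)%N.
Proof. exact: leq_div. Qed.

Lemma pareto_tail K (j : nat) : (\sum_(u < K) (j < pareto u) = K %/ j.+1)%N.
Proof.
have -> : (\sum_(u < K) (j < pareto u) = \sum_(u < K) (u < K %/ j.+1))%N.
  by apply: eq_bigr => u _; rewrite /pareto !leq_divRL // mulnC.
have : (K %/ j.+1 <= K)%N by exact: leq_div.
move: (K %/ j.+1)%N => q; elim: K => [|K IH].
  by rewrite big_ord0; case: q.
rewrite big_ord_recr /= leq_eqVlt => /orP[/eqP ->|].
  rewrite ltnSn; have -> : (\sum_(i < K) (i < K.+1) = \sum_(i < K) 1)%N.
    by apply: eq_bigr => i _; rewrite ltnS ltnW.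
  by rewrite sum1_card card_ord addn1.
by rewrite ltnS => qK; rewrite IH // ltnNge qK addn0.
Qed.

Lemma pareto_generating K z : (0 < K)%N ->
  Ex (fun u : 'I_K => z ^+ pareto u) =
  1 - (1 - z) * \sum_(j < K) z ^+ j * ((K %/ j.+1)%:R / K%:R).
Proof.
move=> K0; have Kn0 : K%:R != 0 :> R by rewrite pnatr_eq0 -lt0n.
rewrite /Ex card_ord.
have -> : \sum_(u < K) z ^+ pareto u =
  \sum_(u < K) (1 - (1 - z) * \sum_(j < K) (j < pareto u)%:R * z ^+ j).
  apply: eq_bigr => u _.
  have -> : \sum_(j < K) (j < pareto u)%:R * z ^+ j = \sum_(j < pareto u) z ^+ j.
    rewrite (big_ord_widen K _ (pareto_le u)) [RHS]big_mkcond /=.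
    by apply: eq_bigr => j _; case: ifP; rewrite ?mul1r ?mul0r.
  by rewrite geometric_sum opprB addrC subrK.
rewrite sumrB sumr_const card_ord -mulr_sumr exchange_big /=.
rewrite mulrBl divff // -mulrA mulr_suml; congr (_ - _ * _).
apply: eq_bigr => j _; rewrite -mulr_suml -(pareto_tail K j) natr_sum.
by rewrite mulrAC mulrC.
Qed.

Lemma divn_approx K d : (0 < K)%N -> (0 < d)%N ->
  `|(K %/ d)%:R / K%:R - d%:R^-1| <= K%:R^-1 :> R.
Proof.
move=> K0 d0; have Kp : 0 < K%:R :> R by rewrite ltr0n.
have dp : 0 < d%:R :> R by rewrite ltr0n.
have E : K%:R = (K %/ d)%:R * d%:R + (K %% d)%:R :> R.
  by rewrite -natrM -natrD -divn_eq.
have r0 : 0 <= (K %% d)%:R :> R by rewrite ler0n.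
have rd : (K %% d)%:R <= d%:R :> R by rewrite ler_nat ltnW // ltn_mod.
have -> : (K %/ d)%:R / K%:R - d%:R^-1 = - ((K %% d)%:R / d%:R * K%:R^-1) :> R.
  have -> : (K %% d)%:R = K%:R - (K %/ d)%:R * d%:R :> R by rewrite {1}E; ring.
  by field; rewrite !lt0r_neq0.
rewrite normrN ger0_norm ?mulr_ge0 ?invr_ge0 ?ler0n//.
by rewrite ler_piMl ?invr_ge0 ?ler0n // ler_pdivrMr // mul1r.
Qed.

Lemma expR_le_inv s : s < 1 -> expR s <= (1 - s)^-1.
Proof.
move=> s1; rewrite -[expR s]invrK -expRN lef_pV2 ?posrE ?expR_gt0 ?subr_gt0 //.
exact: expR_ge1Dx.
Qed.

Lemma pareto_laplace_log K s z : (0 < K)%N -> 0 < s -> s <= 2^-1 ->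
  z = expR (- s) ->
  `|Ex (fun u : 'I_K => expR (- s * (pareto u)%:R)) -
    (1 + (1 - z) * ln (1 - z) / z)| <= K%:R^-1 + 2 / (s * K%:R).
Proof.
move=> K0 s0 s2 zE; have Kp : 0 < K%:R :> R by rewrite ltr0n.
have z0 : 0 < z by rewrite zE expR_gt0.
have z1 : z < 1 by rewrite zE expR_lt1; lra.
under eq_Ex do rewrite expRM_natr.
rewrite pareto_generating // -zE.
set L := ln (1 - z); set S := \sum_(j < K) z ^+ j / j.+1%:R.
set S' := \sum_(j < K) _.
have -> : 1 - (1 - z) * S' - (1 + (1 - z) * L / z) =
  (1 - z) * (S - S') - (1 - z) / z * (z * S + L) by field; lra.
apply: le_trans (ler_normB _ _) _; apply: lerD.
  rewrite normrM ger0_norm ?subr_ge0 ?(ltW z1) //.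
  rewrite /S /S' -sumrB; apply: le_trans (_ : (1 - z) * (\sum_(j < K) z ^+ j * K%:R^-1) <= _).
    rewrite ler_wpM2l ?subr_ge0 ?(ltW z1) //.
    apply: le_trans (ler_norm_sum _ _ _) _; apply: ler_sum => j _.
    rewrite -mulrBr normrM ger0_norm ?exprn_ge0 ?(ltW z0) //.
    by rewrite ler_wpM2l ?exprn_ge0 ?(ltW z0) // distrC divn_approx.
  rewrite -mulr_suml mulrA geometric_sum ler_piMl ?invr_ge0 ?ler0n //.
  by rewrite lerBlDr lerDl exprn_ge0 // ltW.
rewrite normrM ger0_norm ?divr_ge0 ?subr_ge0 ?(ltW z1) ?(ltW z0) //.
apply: le_trans (_ : (1 - z) / z * (z ^+ K / (1 - z)) <= _).
  rewrite ler_wpM2l ?divr_ge0 ?subr_ge0 ?(ltW z1) ?(ltW z0) //.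
  by rewrite log_series_bound // (ltW z0) z1.
have -> : (1 - z) / z * (z ^+ K / (1 - z)) = z^-1 * z ^+ K by field; lra.
have sK : 0 < s * K%:R by rewrite mulr_gt0.
apply: ler_pM; rewrite ?invr_ge0 ?exprn_ge0 ?(ltW z0) //.
  rewrite zE -expRN opprK; apply: le_trans (expR_le_inv _) _; first lra.
  by rewrite -[leRHS]invrK lef_pV2 ?posrE ?invr_gt0; lra.
rewrite zE -expRM_natr mulNr expRN lef_pV2 ?posrE ?expR_gt0 //.
by apply: le_trans (expR_ge1Dx _); rewrite lerDr.
Qed.

Lemma quartic_root s : 0 < s -> exists2 q, 0 < q & s = q ^+ 4.
Proof.
move=> s0; exists (Num.sqrt (Num.sqrt s)); first by rewrite !sqrtr_gt0.
by rewrite (exprM _ 2 2) !sqr_sqrtr ?sqrtr_ge0 // ltW.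
Qed.

Lemma pareto_log_entropy s z : 0 < s -> s <= 2^-1 ->
  z = expR (- s) ->
  `|1 + (1 - z) * ln (1 - z) / z - expR (s * ln s)| <= 26 * (s * Num.sqrt s).
Proof.
move=> s0 s2 zE; have z0 : 0 < z by rewrite zE expR_gt0.
have z1 : z < 1 by rewrite zE expR_lt1; lra.
have [q q0 sq] := quartic_root s0.
have q1 : q <= 1.
  rewrite leNgt; apply/negP => q1; suff : 1 < q ^+ 4 by rewrite -sq; lra.
  by rewrite exprn_egt1.
have sqrts : Num.sqrt s = q ^+ 2.
  by rewrite sq (exprM _ 2 2) sqrtr_sqr ger0_norm // sqr_ge0.
set l := - ln s; set w := 1 - z.
have w0 : 0 < w by rewrite /w; lra.
have ws : w <= s by have := expR_ge1Dx (- s); rewrite /w zE; lra.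
have ws2 : s - s ^+ 2 <= w.
  have : z * (1 + s) <= 1.
    rewrite zE expRN mulrC ler_pdivrMr ?expR_gt0 // mul1r.
    exact: expR_ge1Dx.
  by rewrite /w => H; nra.
have l0 : 0 <= l by rewrite /l oppr_ge0 ln_le0 //; lra.
have lq : l * q <= 4.
  have H : - ln q * q <= 1.
    by rewrite -lnV ?posrE // -ler_pdivlMr // mul1r ltW // ln_sublinear // invr_gt0.
  by rewrite /l sq lnXn // -mulNrn mulrnAl -mulr_natl; lra.
have lw : l <= - ln w.
  by rewrite /l lerN2 ler_ln ?posrE.
have lw2 : w * - ln w <= s * l + s ^+ 2.
  have : ln (s / w) <= s / w - 1.
    by have := @le_ln1Dx _ (s / w - 1); rewrite addrCA subrr addr0;
      apply; rewrite ltrBrDl subrr divr_gt0.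
  rewrite ln_div ?posrE // => H.
  have : w * (ln s - ln w) <= s - w.
    have -> : s - w = w * (s / w - 1) by field; lra.
    by rewrite ler_wpM2l // ltW.
  have : w * l <= s * l by rewrite ler_wpM2r.
  by rewrite /l; nra.
set A := w * - ln w / z.
have Az : A * z = w * - ln w by rewrite /A divfK //; lra.
have zs : 1 - s <= z by rewrite /w in ws; lra.
have A1 : A <= s * l + 2 * s ^+ 2 + 2 * s ^+ 2 * l.
  rewrite -(ler_pM2r z0) Az; apply: le_trans lw2 _.
  have sl0 : 0 <= s ^+ 2 * l by rewrite mulr_ge0 // sqr_ge0.
  apply: le_trans (_ : (s * l + 2 * s ^+ 2 + 2 * s ^+ 2 * l) * (1 - s) <= _); last first.
    by rewrite ler_wpM2l // !addr_ge0 ?mulr_ge0 ?sqr_ge0 //; lra.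
  nra.
have A2 : s * l - s ^+ 2 * l <= A.
  have : w * - ln w <= A.
    by rewrite -(ler_pM2r z0) Az ler_piMr ?(ltW z1) // mulr_ge0 ?(ltW w0) //; lra.
  apply: le_trans; apply: le_trans (_ : w * l <= _).
    by have := ler_wpM2r l0 ws2; lra.
  by rewrite ler_wpM2l // ltW.
have e1 : 1 - s * l <= expR (s * ln s).
  by have := expR_ge1Dx (s * ln s); rewrite /l; lra.
have B0 : 0 <= s * l by rewrite mulr_ge0 // ltW.
have e2 : expR (s * ln s) <= 1 - s * l + (s * l) ^+ 2.
  have -> : s * ln s = - (s * l) by rewrite /l; ring.
  set B := s * l in B0 *; have B3 : 0 <= B ^+ 3 by rewrite exprn_ge0.
  have D0 : 0 < 1 - B + B ^+ 2 by nra.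
  rewrite expRN -[leRHS]invrK lef_pV2 ?posrE ?expR_gt0 ?invr_gt0 //.
  apply: le_trans (expR_ge1Dx _); rewrite -div1r ler_pdivrMr //.
  have -> : (1 + B) * (1 - B + B ^+ 2) = 1 + B ^+ 3 by ring.
  by rewrite lerDl.
have -> : 1 + (1 - z) * ln (1 - z) / z = 1 - A by rewrite /A /w; ring.
rewrite sqrts.
have b1 : s ^+ 2 <= s * q ^+ 2.
  by rewrite expr2 ler_wpM2l ?(ltW s0) // sq (exprM _ 2 2) expr2
       ler_piMr ?sqr_ge0 // expr_le1 // ltW.
have b2 : s ^+ 2 * l <= 4 * (s * q ^+ 2).
  have -> : s ^+ 2 * l = s * (q ^+ 3 * (l * q)) by rewrite sq; ring.
  have -> : 4 * (s * q ^+ 2) = s * (q ^+ 2 * 4) by ring.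
  rewrite ler_wpM2l ?(ltW s0) // ler_pM ?exprn_ge0 ?(ltW q0) //.
    by rewrite mulr_ge0 // ltW.
  by rewrite exprS ler_piMl ?exprn_ge0 // ltW.
have b3 : (s * l) ^+ 2 <= 16 * (s * q ^+ 2).
  have -> : (s * l) ^+ 2 = s * (q ^+ 2 * (l * q) ^+ 2) by rewrite sq; ring.
  have -> : 16 * (s * q ^+ 2) = s * (q ^+ 2 * 4 ^+ 2) by ring.
  rewrite ler_wpM2l ?(ltW s0) // ler_wpM2l ?sqr_ge0 // lerXn2r // ?nnegrE //.
  by rewrite mulr_ge0 // ltW.
have q2 : 0 <= s * q ^+ 2 by rewrite mulr_ge0 ?sqr_ge0 // ltW.
by rewrite ler_norml; apply/andP; split; lra.
Qed.

Lemma pareto_laplace K s : (0 < K)%N -> 0 < s -> s <= 2^-1 ->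
  `|Ex (fun u : 'I_K => expR (- s * (pareto u)%:R)) - expR (s * ln s)|
    <= 26 * (s * Num.sqrt s) + (K%:R^-1 + 2 / (s * K%:R)).
Proof.
move=> K0 s0 s2.
have H2 := pareto_laplace_log K0 s0 s2 erefl; have H1 := pareto_log_entropy s0 s2 erefl.
by rewrite [leRHS]addrC; exact: le_trans (ler_distD _ _ _) (lerD H2 H1).
Qed.

End Pareto.

Section ProductApprox.
Variables (R : realType) (I : finType).

Lemma prod_approx (x b tau : I -> R) :
  (forall i, 0 <= b i) -> (forall i, 0 <= tau i <= 2^-1) ->
  (forall i, `|x i - b i| <= tau i * b i) ->
  (\prod_i b i) * expR (- 2 * \sum_i tau i) <= \prod_i x i
    <= (\prod_i b i) * expR (\sum_i tau i).
Proof.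
move=> b0 t0 xb; rewrite mulr_sumr !expR_sum -!big_split /=.
have lo i : 0 <= b i * expR (- 2 * tau i) <= x i.
  have /andP[t1 t2] := t0 i; have := xb i; have := b0 i.
  rewrite mulr_ge0 ?expR_ge0 //= ler_norml => bi /andP[H _].
  apply: le_trans (_ : b i * (1 - tau i) <= _); last lra.
  rewrite ler_wpM2l // mulNr expRN -[leRHS]invrK lef_pV2 ?posrE ?expR_gt0 ?invr_gt0; try lra.
  apply: le_trans (expR_ge1Dx _); rewrite -div1r ler_pdivrMr; nra.
apply/andP; split; apply: ler_prod => i _; first exact: lo.
have /andP[t1 t2] := t0 i; have := xb i; have := b0 i.
have /andP[l1 l2] := lo i; rewrite (le_trans l1 l2) /=.
rewrite ler_norml => bi /andP[_ H].
apply: le_trans (_ : b i * (1 + tau i) <= _); first lra.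
by rewrite ler_wpM2l // expR_ge1Dx.
Qed.

End ProductApprox.

Section Sketch.
Variables (R : realType) (n N K : nat) (x : 'I_n -> nat).
Let S := (\sum_i x i)%N.

Definition weight (a : {ffun 'I_n * 'I_N -> 'I_K}) (i : 'I_n) : nat :=
  (\sum_l pareto (a (i, l)))%N.

Definition sketch (a : {ffun 'I_n * 'I_N -> 'I_K}) : nat :=
  (\sum_i x i * weight a i)%N.

Definition sketch_exp (theta : R) (a : {ffun 'I_n * 'I_N -> 'I_K}) : R :=
  expR (- (theta / (S%:R * N%:R)) * (sketch a)%:R).

Definition prob i : R := (x i)%:R / S%:R.

Definition shannon : R := \sum_i prob i * ln (1 / prob i).

Hypotheses (S0 : (0 < S)%N) (K0 : (0 < K)%N) (N4 : (4 <= N)%N).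

Let Sp : 0 < S%:R :> R. Proof. by rewrite ltr0n. Qed.
Let Kp : 0 < K%:R :> R. Proof. by rewrite ltr0n. Qed.
Let Np : 0 < N%:R :> R. Proof. by rewrite ltr0n; apply: leq_trans N4. Qed.

Lemma prob_sum : \sum_i prob i = 1.
Proof. by rewrite /prob -mulr_suml -natr_sum divff // lt0r_neq0. Qed.

Lemma prob_ge0 i : 0 <= prob i.
Proof. by rewrite /prob divr_ge0 ?ler0n. Qed.

Lemma prob_le1 i : prob i <= 1.
Proof.
by rewrite -prob_sum (bigD1 i) //= lerDl sumr_ge0 // => j _; exact: prob_ge0.
Qed.

Lemma Ex_sketch (theta : R) :
  Ex (sketch_exp theta) =
  \prod_(il : 'I_n * 'I_N)
     Ex (fun u : 'I_K => expR (- (theta * prob il.1 / N%:R) * (pareto u)%:R)).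
Proof.
rewrite -Ex_prod; apply: eq_Ex => a; rewrite /sketch_exp -expR_sum; congr expR.
rewrite /sketch natr_sum mulr_sumr.
transitivity (\sum_i \sum_l - (theta * prob i / N%:R) * (pareto (a (i, l)))%:R : R);
  last by rewrite pair_bigA /=; apply: eq_bigr => -[].
apply: eq_bigr => i _; rewrite -mulr_sumr -natr_sum natrM mulrA; congr (_ * _).
by rewrite /prob; field; rewrite !lt0r_neq0.
Qed.

Lemma expR_entropy_ge (s : R) : 0 < s -> 4^-1 <= expR (s * ln s).
Proof.
move=> s0; have H : s - 1 <= s * ln s.
  have := @le_ln1Dx _ (s^-1 - 1); rewrite addrCA subrr addr0 lnV ?posrE // => H.
  have {}H : - ln s <= s^-1 - 1 by apply: H; rewrite ltrBrDl subrr invr_gt0.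
  have -> : s - 1 = s * - (s^-1 - 1) by field; rewrite lt0r_neq0.
  by rewrite ler_wpM2l ?(ltW s0) //; lra.
apply: le_trans (_ : expR (2%:R * - 2^-1) <= _).
  rewrite expRM_natl; have := expR_ge1Dx (- 2^-1 : R) => E.
  apply: le_trans (_ : (1 - 2^-1) ^+ 2 <= _); first lra.
  by rewrite lerXn2r ?nnegrE ?expR_ge0 //; lra.
by rewrite ler_expR; lra.
Qed.

Lemma Ex_sketch_approx (theta nu : R) : 1 <= theta <= 2 -> nu <= 2^-1 ->
  208 * Num.sqrt (2 / N%:R) + 4 * n%:R * N%:R * (1 + 2 * N%:R * S%:R) / K%:R <= nu ->
  let T := expR (theta * (- shannon + ln theta - ln N%:R)) in
  (T * expR (- 2 * nu) <= Ex (sketch_exp theta)) /\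
  (Ex (sketch_exp theta) <= T * expR nu).
Proof.
move=> /andP[th1 th2] nu2 nuE T.
pose s (i : 'I_n) := theta * prob i / N%:R.
have tp : 0 < theta by lra.
have N4R : 4 <= N%:R :> R by rewrite ler_nat.
have s0 i : 0 <= s i.
  by apply: divr_ge0; rewrite ?ler0n //; apply: mulr_ge0; [lra|exact: prob_ge0].
have s2 i : s i <= 2 * prob i / N%:R.
  by rewrite ler_pM2r ?invr_gt0 // ler_wpM2r ?prob_ge0.
have sN i : s i <= 2 / N%:R.
  by apply: le_trans (s2 i) _; rewrite ler_pM2r ?invr_gt0 // ler_piMr // prob_le1.
have shalf i : s i <= 2^-1.
  apply: le_trans (sN i) _; rewrite ler_pdivrMr //; lra.
pose sg : R := Num.sqrt (2 / N%:R).
pose C : R := 104 * sg.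
pose D : R := 4 * (1 + 2 * N%:R * S%:R) / K%:R.
pose tau (il : 'I_n * 'I_N) := C * s il.1 + D.
have sg0 : 0 <= sg by exact: sqrtr_ge0.
have D0 : 0 <= D by rewrite divr_ge0 ?mulr_ge0 ?addr_ge0 ?mulr_ge0 ?ler0n // ltW.
have C0 : 0 <= C by rewrite /C mulr_ge0.
have tau0 il : 0 <= tau il by apply: addr_ge0 => //; apply: mulr_ge0 => //; exact: s0.
have sum_tau : \sum_il tau il <= nu.
  apply: le_trans nuE; rewrite -(pair_bigA _ (fun i l => C * s i + D)) /=.
  have -> : \sum_i \sum_(l < N) (C * s i + D) = N%:R * (C * \sum_i s i + n%:R * D).
    rewrite (eq_bigr (fun i => N%:R * (C * s i + D))) => [|i _]; last first.
      by rewrite sumr_const card_ord mulr_natl.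
    rewrite -mulr_sumr big_split /= -mulr_sumr sumr_const card_ord.
    by rewrite (mulr_natl D).
  have -> : \sum_i s i = theta / N%:R.
    by rewrite /s -mulr_suml -mulr_sumr prob_sum mulr1.
  rewrite mulrDr; apply: lerD.
    rewrite /C -/sg; have -> : N%:R * (104 * sg * (theta / N%:R)) = 104 * theta * sg.
      by field; rewrite lt0r_neq0.
    by rewrite ler_wpM2r //; lra.
  by rewrite /D le_eqVlt; apply/orP; left; apply/eqP; field; rewrite lt0r_neq0.
pose b (il : 'I_n * 'I_N) := expR (s il.1 * ln (s il.1)).
have tau_half il : 0 <= tau il <= 2^-1.
  rewrite tau0; apply: le_trans nu2; apply: le_trans sum_tau.
  by rewrite (bigD1 il) //= lerDl sumr_ge0.
have prodb : \prod_il b il = T.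
  rewrite -expR_sum /T; congr expR.
  rewrite -(pair_bigA _ (fun i (l : 'I_N) => s i * ln (s i))) /=.
  have -> : theta * (- shannon + ln theta - ln N%:R) =
     \sum_i (theta * (- (prob i * ln (1 / prob i)) + prob i * ln theta - prob i * ln N%:R)).
    have E (y : R) : \sum_i prob i * y = y by rewrite -mulr_suml prob_sum mul1r.
    by rewrite -mulr_sumr sumrB big_split /= !E sumrN.
  apply: eq_bigr => i _; rewrite sumr_const card_ord -[_ *+ N]mulr_natl /s.
  have [->|p0] := eqVneq (prob i) 0; first by rewrite !(mulr0, mul0r); ring.
  have : 0 < prob i by rewrite lt_def p0 prob_ge0.
  move: (prob i) => q qp.
  rewrite ln_div ?posrE ?mulr_gt0 //.
  rewrite lnM ?posrE //.
  rewrite div1r lnV ?posrE //; field; rewrite ?lt0r_neq0 ?Np //.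
have xb il : `|Ex (fun u : 'I_K => expR (- (theta * prob il.1 / N%:R) * (pareto u)%:R))
    - b il| <= tau il * b il.
  have [pz|pz] := eqVneq (prob il.1) 0.
    rewrite /b /s pz mulr0 !mul0r oppr0 expR0.
    under eq_Ex do rewrite mul0r expR0.
    by rewrite Ex_cst ?card_ord // subrr normr0 mulr1 tau0.
  have ppos : 0 < prob il.1 by rewrite lt_def pz prob_ge0.
  have sp : 0 < s il.1 by rewrite divr_gt0 ?(mulr_gt0 tp ppos).
  apply: le_trans (pareto_laplace K0 sp (shalf _)) _.
  apply: le_trans (_ : tau il * 4^-1 <= _); last first.
    by rewrite ler_wpM2l ?tau0 // expR_entropy_ge.
  have ssg : Num.sqrt (s il.1) <= sg by rewrite ler_sqrt // (le_trans _ (sN il.1)).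
  have e1 : s il.1 * Num.sqrt (s il.1) <= s il.1 * sg by rewrite ler_wpM2l.
  have e2 : 2 / (s il.1 * K%:R) <= 2 * N%:R * S%:R / K%:R.
    have x1 : 1 <= (x il.1)%:R :> R.
      rewrite ler1n lt0n; apply: contraNneq pz => E.
      by rewrite /prob E mul0r.
    have sNS : s il.1 * (N%:R * S%:R) = theta * (x il.1)%:R.
      by rewrite /s /prob; field; do ?[apply/andP; split]; rewrite lt0r_neq0.
    rewrite invfM mulrA ler_pM2r ?invr_gt0 // -mulrA ler_wpM2l //.
    rewrite -div1r ler_pdivrMr // mulrC sNS; nra.
  have DE : D = 4 * K%:R^-1 + 4 * (2 * N%:R * S%:R / K%:R) :> R.
    by rewrite /D; field; rewrite lt0r_neq0.
  have tE : tau il = 104 * sg * s il.1 + D by [].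
  rewrite tE {tE} DE; lra.
have /andP[lo hi] := prod_approx (fun il => expR_ge0 _) tau_half xb.
have T0 : 0 <= T by exact: expR_ge0.
rewrite Ex_sketch; split.
  apply: le_trans lo; rewrite -[\prod_i _]/(\prod_il b il) prodb ler_wpM2l // ler_expR; lra.
apply: le_trans hi _; rewrite -[\prod_i _]/(\prod_il b il) prodb ler_wpM2l // ler_expR; lra.
Qed.

End Sketch.

Local Open Scope nat_scope.

(** * Random rounding of tree sums *)

Section Rounding.
Variables b Q : nat.
Implicit Types x r : nat.

(* Unit in the last place of a number with [b + 1] mantissa bits, capped at [2 ^ Q] so that
   it always divides the number of values of a coin. *)
Definition expo x : nat := minn (trunc_log 2 x - b) Q.
Definition step x : nat := 2 ^ expo x.
Definition rnd_down x : nat := x %/ step x * step x.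
Definition rnd x (c : 'I_(2 ^ Q)) : nat :=
  rnd_down x + (c %% step x < x %% step x) * step x.

Definition float_val (p : 'I_Q.+1 * 'I_(2 ^ b.+1).+1) : nat := p.2 * 2 ^ p.1.

Definition grid r : Prop :=
  exists e mu, [/\ r = mu * 2 ^ e, e <= Q & (mu <= 2 ^ b.+1) || (e == Q)].

Lemma step_gt0 x : 0 < step x.
Proof. by rewrite expn_gt0. Qed.

Lemma rnd_downE x : x = rnd_down x + x %% step x.
Proof. exact: divn_eq. Qed.

Lemma step_dvd_max x : step x %| 2 ^ Q.
Proof. by rewrite dvdn_exp2l // geq_minr. Qed.

Lemma expo_gt0_le x : 0 < expo x -> 2 ^ (b + expo x) <= x.
Proof.
rewrite /expo => H; have x0 : 0 < x by case: x H => [|//]; rewrite trunc_log0 sub0n min0n.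
have /andP[Hx _] := trunc_log_bounds (ltnSn 1) x0.
by apply: leq_trans Hx; rewrite leq_exp2l //; lia.
Qed.

Lemma step_relative x : x %% step x * (step x * 2 ^ b) <= x %% step x * x.
Proof.
have [e0|e0] := posnP (expo x); first by rewrite /step e0 expn0 modn1 !mul0n.
by rewrite leq_mul2l /step -expnD addnC expo_gt0_le ?orbT.
Qed.

Lemma grid_le_rnd_down r x : grid r -> r <= x -> r <= rnd_down x.
Proof.
move=> [e [mu [-> eQ H]]] rx; have [ex|ex] := leqP (expo x) e.
  move: rx; have /dvdnP[k ->] : step x %| mu * 2 ^ e.
    by rewrite dvdn_mull // dvdn_exp2l.
  by rewrite -leq_divRL ?step_gt0 // /rnd_down leq_mul2r => ->; rewrite orbT.
have eQ' : e < Q by apply: leq_trans ex (geq_minr _ _).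
rewrite (ltn_eqF eQ') orbF in H.
have H1 : mu * 2 ^ e <= 2 ^ (b + expo x).
  apply: leq_trans (_ : 2 ^ b.+1 * 2 ^ e <= _); first by rewrite leq_mul2r H orbT.
  by rewrite -expnD leq_exp2l // addSnnS leq_add2l.
apply: leq_trans H1 _; rewrite expnD /rnd_down leq_mul2r.
rewrite leq_divRL ?step_gt0 // -expnD expo_gt0_le ?orbT //.
exact: leq_ltn_trans ex.
Qed.

Lemma rnd_grid x c : grid (rnd x c).
Proof.
exists (expo x), (x %/ step x + (c %% step x < x %% step x)); split.
- by rewrite mulnDl.
- exact: geq_minr.
have [_|eQ] := eqVneq (expo x) Q; first by rewrite orbT.
rewrite orbF; apply: leq_trans (_ : (x %/ step x).+1 <= _).
  by case: (c %% _ < _); rewrite ?addn1 ?addn0.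
rewrite ltn_divLR ?step_gt0 // -expnD.
have [->|x0] := posnP x; first by rewrite expn_gt0.
have /andP[_ Hx] := trunc_log_bounds (ltnSn 1) x0.
apply: leq_trans Hx _; rewrite leq_exp2l //.
by move: eQ; rewrite /expo; lia.
Qed.

Lemma grid_float r : grid r -> r < 2 ^ (b.+1 + Q) -> exists p, float_val p = r.
Proof.
move=> [e [mu [-> eQ H]]] rlt.
have mub : mu <= 2 ^ b.+1.
  case/orP: H => [//|/eqP eE].
  by move: rlt; rewrite eE expnD ltn_pmul2r ?expn_gt0 // => /ltnW.
by exists (inord e, inord mu); rewrite /float_val /= !inordK.
Qed.

Lemma sum_modn_lt q st rho : rho <= st ->
  \sum_(0 <= c < q * st) (c %% st < rho) = q * rho.
Proof.
move=> rs; elim: q => [|q IH]; first by rewrite !mul0n big_nil.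
rewrite (@big_cat_nat _ _ _ (q * st)) ?leq_mul2r ?leqnSn ?orbT //= IH mulSn.
rewrite -{1}[q * st]add0n big_addn addnK.
have -> : \sum_(0 <= i < st) ((i + q * st) %% st < rho) = \sum_(0 <= i < st) (i < rho).
  by apply: eq_big_nat => i /andP[_ ist]; rewrite addnC modnMDl modn_small.
rewrite addnC mulSn; congr (_ + _).
rewrite (@big_cat_nat _ _ _ rho) //=.
have -> : \sum_(rho <= i < st) (i < rho) = 0.
  by rewrite big_nat big1 // => i /andP[H _]; rewrite ltnNge H.
rewrite addn0.
have -> : \sum_(0 <= i < rho) (i < rho) = \sum_(0 <= i < rho) 1.
  by apply: eq_big_nat => i /andP[_ ->].
by rewrite sum_nat_const_nat muln1 subn0.
Qed.

Lemma sum_rnd_up x :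
  step x * \sum_(c < 2 ^ Q) (c %% step x < x %% step x) = 2 ^ Q * (x %% step x).
Proof.
have /dvdnP[q E] := step_dvd_max x.
rewrite -(big_mkord xpredT (fun c => nat_of_bool (c %% step x < x %% step x))) E.
by rewrite sum_modn_lt ?(ltnW (ltn_pmod _ (step_gt0 x))) // mulnA (mulnC q).
Qed.

End Rounding.

Local Open Scope ring_scope.

Section RoundingMoments.
Variables (R : realType) (b Q : nat).
Implicit Types x : nat.

Let up x (c : 'I_(2 ^ Q)) : R := (c %% step b Q x < x %% step b Q x)%:R.

Let rndE x c : (rnd b x c)%:R - x%:R = (step b Q x)%:R * up x c - (x %% step b Q x)%:R.
Proof.
have -> : x%:R = (rnd_down b Q x)%:R + (x %% step b Q x)%:R :> R.
  by rewrite -natrD -rnd_downE.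
by rewrite /rnd natrD natrM /up; ring.
Qed.

Let card0 : (0 < #|'I_(2 ^ Q)|)%N. Proof. by rewrite card_ord expn_gt0. Qed.

Let Ex_up x : (step b Q x)%:R * Ex (up x) = (x %% step b Q x)%:R.
Proof.
rewrite /Ex card_ord mulrA -natr_sum -natrM sum_rnd_up natrM mulrC mulrA mulVf ?mul1r //.
by rewrite pnatr_eq0 -lt0n expn_gt0.
Qed.

Lemma rnd_unbiased x : \sum_(c : 'I_(2 ^ Q)) ((rnd b x c)%:R - x%:R) = 0 :> R.
Proof.
apply/eqP; have : Ex (fun c : 'I_(2 ^ Q) => (rnd b x c)%:R - x%:R : R) == 0.
  apply/eqP; under eq_Ex do rewrite rndE.
  by rewrite ExD ExZ Ex_up Ex_cst // subrr.
rewrite /Ex mulf_eq0 invr_eq0 pnatr_eq0 card_ord => /orP[//|].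
by rewrite expn_eq0.
Qed.

Lemma rnd_variance x :
  Ex (fun c : 'I_(2 ^ Q) => ((rnd b x c)%:R - x%:R) ^+ 2 : R)
    <= (2 ^ b)%:R^-1 * (x%:R * (x%:R - (rnd_down b Q x)%:R)).
Proof.
set st := step b Q x; set rho := (x %% st)%N.
have -> : x%:R - (rnd_down b Q x)%:R = rho%:R :> R.
  by rewrite {1}[x](rnd_downE b Q) natrD addrC addKr.
have -> : Ex (fun c : 'I_(2 ^ Q) => ((rnd b x c)%:R - x%:R) ^+ 2 : R)
   = rho%:R * (st%:R - rho%:R).
  transitivity (Ex (fun c => (st%:R * (st%:R - 2 * rho%:R)) * up x c + rho%:R ^+ 2)).
    apply: eq_Ex => c; rewrite rndE -/st -/rho.
    have : up x c = 0 \/ up x c = 1 by rewrite /up; case: (_ < _)%N; [right|left].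
    by case=> ->; ring.
  rewrite ExD ExZ Ex_cst // -mulrA mulrCA Ex_up -/st -/rho; ring.
have H : (rho * (st * 2 ^ b))%:R <= (rho * x)%:R :> R by rewrite ler_nat step_relative.
have bp : 0 < (2 ^ b)%:R :> R by rewrite ltr0n expn_gt0.
rewrite [leRHS]mulrC ler_pdivlMr //; move: H; rewrite !natrM.
have : 0 <= rho%:R * rho%:R * (2 ^ b)%:R :> R by rewrite !mulr_ge0 ?ler0n.
by lra.
Qed.

End RoundingMoments.

Local Open Scope nat_scope.

Section Tree.
Variables (m : nat) (o : 'I_m) (par : 'I_m -> 'I_m) (d : 'I_m -> nat) (D : nat).
Hypothesis dpar : forall u, u != o -> d u = (d (par u)).+1.
Hypothesis dD : forall u, d u <= D.

Definition child (v c : 'I_m) : bool := (c != o) && (par c == v).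

Lemma child_depth v c : child v c -> d c = (d v).+1.
Proof. by case/andP => co /eqP <-; exact: dpar. Qed.

Lemma tree_ind (P : 'I_m -> Prop) :
  (forall v, (forall c, child v c -> P c) -> P v) -> forall v, P v.
Proof.
move=> H v; have [k] := ubnP (D - d v).
elim: k v => [|k IH] v; first by rewrite ltn0.
move=> vk; apply: H => c cv; apply: IH.
by have := child_depth cv; have := dD c; lia.
Qed.

Section Fold.
Variables (A : Type) (a0 : A) (F : 'I_m -> ('I_m -> A) -> A).
Hypothesis Fext : forall v g h, (forall c, child v c -> g c = h c) -> F v g = F v h.

Fixpoint tree_iter k v : A :=
  if k is k'.+1 then F v (tree_iter k') else a0.

Definition tree_fold v := tree_iter (D - d v).+1 v.

Lemma tree_foldE v : tree_fold v = F v tree_fold.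
Proof.
apply: Fext => c cv; rewrite /tree_fold; congr tree_iter.
by have := child_depth cv; have := dD c; lia.
Qed.

End Fold.

Local Open Scope ring_scope.

Lemma sum_child (V : nmodType) (f : 'I_m -> V) :
  \sum_v \sum_(c | child v c) f c = \sum_(c | c != o) f c.
Proof.
rewrite (exchange_big_dep (fun c => c != o)) /=; last by move=> v c _ /andP[].
apply: eq_bigr => c co; rewrite (bigD1 (par c)) /=; last by rewrite /child co eqxx.
rewrite big1 ?addr0 // => v /andP[/andP[_ /eqP ->]].
by rewrite eqxx.
Qed.

Section Counter.
Variables (R : realType) (b Q : nat) (a : 'I_m -> nat).
Let Omega := {ffun 'I_m -> 'I_(2 ^ Q)}.
Variable r : Omega -> 'I_m -> nat.

Definition merged (w : Omega) v : nat := (a v + \sum_(c | child v c) r w c)%N.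

Hypothesis rE : forall w v, r w v = rnd b (merged w v) (w v).

Let total : R := (\sum_v a v)%:R.
Let xi v w : R := (r w v)%:R - (merged w v)%:R.
Let card0 : (0 < #|'I_(2 ^ Q)|)%N. Proof. by rewrite card_ord expn_gt0. Qed.
Let cardO : (0 < #|Omega|)%N. Proof. by rewrite card_ffun expn_gt0 card0. Qed.

Lemma counter_upd w u c v : v != u -> (d u <= d v)%N -> r (upd w u c) v = r w v.
Proof.
elim/tree_ind: v => v IH vu duv; rewrite !rE /upd ffunE (negPf vu).
congr rnd; rewrite /merged; congr (_ + _)%N; apply: eq_bigr => e ev.
have de := child_depth ev.
apply: IH => //; last by rewrite de ltnW.
by apply: contraTneq duv => <-; rewrite de ltnn.
Qed.

Lemma merged_upd w u c v : (d u <= d v)%N -> merged (upd w u c) v = merged w v.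
Proof.
move=> duv; rewrite /merged; congr (_ + _)%N; apply: eq_bigr => e ev.
have de := child_depth ev.
apply: counter_upd; last by rewrite de ltnW.
by apply: contraTneq duv => <-; rewrite de ltnn.
Qed.

Lemma xi_centered v w : \sum_c xi v (upd w v c) = 0.
Proof.
transitivity (\sum_(c : 'I_(2 ^ Q)) ((rnd b (merged w v) c)%:R - (merged w v)%:R : R));
  last exact: rnd_unbiased.
by apply: eq_bigr => c _; rewrite /xi rE merged_upd // ffunE eqxx.
Qed.

Lemma Ex_xi_mul v (g : Omega -> R) :
  (forall w c, g (upd w v c) = g w) -> Ex (fun w => xi v w * g w) = 0.
Proof. by move=> gi; apply: (Ex_orthogonal card0 gi) => w; exact: xi_centered. Qed.

Lemma Ex_xi v : Ex (xi v) = 0.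
Proof.
rewrite -(@Ex_xi_mul v (fun=> 1)) //.
by apply: eq_Ex => w; rewrite mulr1.
Qed.

Lemma Ex_xi_orthogonal u v : u != v -> Ex (fun w => xi u w * xi v w) = 0.
Proof.
wlog duv : u v / (d u <= d v)%N.
  move=> H uv; case: (leqP (d u) (d v)) => [|/ltnW] duv; first exact: H.
  under eq_Ex do rewrite mulrC.
  by apply: H => //; rewrite eq_sym.
move=> uv; apply: Ex_xi_mul => w c.
by rewrite /xi counter_upd 1?eq_sym // merged_upd.
Qed.

Lemma counter_decomposition w : (r w o)%:R = total + \sum_v xi v w.
Proof.
have E : \sum_v (r w v)%:R = \sum_v ((merged w v)%:R + xi v w).
  by apply: eq_bigr => v _; rewrite /xi addrC subrK.
move: E; rewrite big_split /=.
have -> : \sum_v (merged w v)%:R = total + \sum_(c | c != o) (r w c)%:R :> R.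
  rewrite -sum_child /total natr_sum -big_split /=; apply: eq_bigr => v _.
  by rewrite /merged natrD natr_sum.
rewrite (bigD1 o) //= addrAC => /addIr; exact.
Qed.

Lemma Ex_counter : Ex (fun w => (r w o)%:R) = total.
Proof.
rewrite (eq_Ex counter_decomposition) ExD Ex_cst // Ex_sum big1 ?addr0 // => v _.
exact: Ex_xi.
Qed.

Let T : R := \sum_v Ex (fun w => xi v w ^+ 2).

Lemma Ex_counter_dev : Ex (fun w => ((r w o)%:R - total) ^+ 2) = T.
Proof.
transitivity (Ex (fun w => \sum_u \sum_v xi u w * xi v w)).
  by apply: eq_Ex => w; rewrite counter_decomposition addrC addKr expr2 big_distrlr.
rewrite Ex_sum; apply: eq_bigr => u _; rewrite Ex_sum (bigD1 u) //= big1 ?addr0.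
  by apply: eq_Ex => w; rewrite expr2.
by move=> v vu; rewrite Ex_xi_orthogonal // eq_sym.
Qed.

(* All children carry grid values, at most [rnd_down x], hence
   [\sum_c r_c ^+ 2 <= rnd_down x * x]. *)
Lemma Ex_xi_sqr v : Ex (fun w => xi v w ^+ 2) <= (2 ^ b)%:R^-1 *
  Ex (fun w => (merged w v)%:R ^+ 2 - \sum_(c | child v c) (r w c)%:R ^+ 2).
Proof.
rewrite (Ex_resample v _ card0) -ExZ; apply: le_Ex => w.
apply: le_trans (_ : Ex (fun c : 'I_(2 ^ Q) => 
  ((rnd b (merged w v) c)%:R - (merged w v)%:R) ^+ 2) <= _).
  by apply: le_Ex => c; rewrite /xi rE merged_upd // ffunE eqxx.
apply: le_trans (rnd_variance _ _ _ _) _.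
rewrite ler_wpM2l ?invr_ge0 ?ler0n // expr2 mulrBr lerB //.
set x := merged w v; set g := rnd_down b Q x.
apply: le_trans (_ : \sum_(c | child v c) (r w c)%:R * g%:R <= _).
  apply: ler_sum => c cv; rewrite expr2 ler_wpM2l ?ler0n // ler_nat.
  apply: grid_le_rnd_down; first by rewrite rE; exact: rnd_grid.
  by rewrite /x /merged (bigD1 c) //= addnCA leq_addr.
rewrite -mulr_suml ler_wpM2r ?ler0n // -natr_sum ler_nat.
by rewrite /x /merged leq_addl.
Qed.

(* Summed over the tree, the bounds of [Ex_xi_sqr] telescope since [r_v ^+ 2] exceeds
   [merged v ^+ 2] on average. *)
Lemma counter_variance : (1 <= b)%N ->
  Ex (fun w => ((r w o)%:R - total) ^+ 2) <= 2 / (2 ^ b)%:R * total ^+ 2.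
Proof.
move=> b1; set g : R := (2 ^ b)%:R^-1; rewrite -/g.
have g0 : 0 <= g by rewrite invr_ge0 ler0n.
have g2 : g <= 2^-1.
  by rewrite lef_pV2 ?posrE ?ltr0n ?expn_gt0 // (_ : 2 = (2 ^ 1)%:R) // ler_nat leq_exp2l.
have rsqr v : Ex (fun w => (r w v)%:R ^+ 2) =
    Ex (fun w => (merged w v)%:R ^+ 2) + Ex (fun w => xi v w ^+ 2).
  have -> : Ex (fun w => (r w v)%:R ^+ 2) = Ex (fun w => ((merged w v)%:R ^+ 2
     + xi v w ^+ 2) + 2 * (xi v w * (merged w v)%:R)).
    by apply: eq_Ex => w; rewrite /xi; ring.
  rewrite ExD ExD ExZ (Ex_xi_mul (g := fun w => (merged w v)%:R)) ?mulr0 ?addr0 //.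
  by move=> w c; rewrite merged_upd.
have xi0 v : 0 <= Ex (fun w => xi v w ^+ 2) by apply: Ex_ge0 => w; exact: sqr_ge0.
have T0 : 0 <= T by exact: sumr_ge0.
have second : Ex (fun w => (r w o)%:R ^+ 2) = T + total ^+ 2.
  rewrite -Ex_counter_dev.
  have -> : Ex (fun w => (r w o)%:R ^+ 2) =
    Ex (fun w => (((r w o)%:R - total) ^+ 2 + 2 * total * (r w o)%:R) + - total ^+ 2).
    by apply: eq_Ex => w; ring.
  by rewrite ExD ExD ExZ Ex_counter Ex_cst //; ring.
have main : T <= g * Ex (fun w => (merged w o)%:R ^+ 2).
  apply: le_trans (ler_sum _ (fun v _ => Ex_xi_sqr v)) _.
  rewrite -mulr_sumr ler_wpM2l //.
  have E v : Ex (fun w => (merged w v)%:R ^+ 2 - \sum_(c | child v c) (r w c)%:R ^+ 2)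
     = Ex (fun w => (merged w v)%:R ^+ 2)
       - \sum_(c | child v c) Ex (fun w => (r w c)%:R ^+ 2) :> R.
    rewrite ExD -Ex_sum -[- Ex _]mulN1r -ExZ; congr (_ + _).
    by apply: eq_Ex => w; rewrite mulN1r.
  under eq_bigr do rewrite E.
  rewrite sumrB sum_child (bigD1 o) //= -addrA gerDl subr_le0.
  by apply: ler_sum => v _; rewrite rsqr lerDl.
have := rsqr o; have := xi0 o; rewrite second Ex_counter_dev.
set M := Ex _ in main *; set X := Ex _ => X0 ME.
have M1 : M <= T + total ^+ 2 by lra.
have : T <= g * (T + total ^+ 2) by apply: le_trans main _; rewrite ler_wpM2l.
have : g * T <= 2^-1 * T by rewrite ler_wpM2r.
by lra.
Qed.

Lemma Ex_counter_le v : Ex (fun w => (r w v)%:R) <= total.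
Proof.
have E u : Ex (fun w => (r w u)%:R)
    = (a u)%:R + \sum_(c | child u c) Ex (fun w => (r w c)%:R) :> R.
  transitivity (Ex (fun w => (merged w u)%:R + xi u w)).
    by apply: eq_Ex => w; rewrite /xi addrC subrK.
  rewrite ExD Ex_xi addr0 -Ex_sum.
  transitivity (Ex (fun w => (a u)%:R + \sum_(c | child u c) (r w c)%:R : R)).
    by apply: eq_Ex => w; rewrite /merged natrD natr_sum.
  by rewrite ExD Ex_cst.
have r0 u : 0 <= Ex (fun w => (r w u)%:R) :> R by apply: Ex_ge0 => w; exact: ler0n.
have [k] := ubnP (d v); elim: k v => [|k IH] v; first by rewrite ltn0.
move=> vk.
have [->|vo] := eqVneq v o; first by rewrite Ex_counter.
apply: le_trans (IH (par v) _); last by have := dpar vo; lia.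
rewrite [leRHS]E (bigD1 v) /=; last by rewrite /child vo eqxx.
by rewrite addrCA lerDl addr_ge0 ?ler0n // sumr_ge0.
Qed.

End Counter.
End Tree.

Local Open Scope nat_scope.

(** * Aggregation protocols on a spanning tree *)

Lemma spanning_tree (m : nat) (e : rel 'I_m) (o : 'I_m) :
  (forall u v, connect e u v) ->
  exists (par : 'I_m -> 'I_m) (d : 'I_m -> nat),
    [/\ forall u, u != o -> e u (par u),
        forall u, u != o -> d u = (d (par u)).+1 & d o = 0].
Proof.
move=> conn.
have exk u : exists k, [exists p : k.-tuple 'I_m, path e u p && (last u p == o)].
  have /connectP[p pth lst] := conn u o.
  by exists (size p); apply/existsP; exists (in_tuple p); rewrite pth -lst eqxx.
pose d u := ex_minn (exk u).
have dP u : exists2 p, path e u p /\ last u p = o & size p = d u.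
  rewrite /d; case: ex_minnP => k /existsP[p /andP[pth /eqP lst]] _.
  by exists p => //; rewrite size_tuple.
have d_min u p : path e u p -> last u p = o -> d u <= size p.
  move=> pth lst; rewrite /d; case: ex_minnP => k _; apply.
  by apply/existsP; exists (in_tuple p); rewrite pth lst eqxx.
have step u : u != o -> exists2 v, e u v & d u = (d v).+1.
  move=> uo; have [[|v p] [/= pth lst] sz] := dP u; first by rewrite lst eqxx in uo.
  case/andP: pth => euv pth; exists v => //; apply/eqP; rewrite eqn_leq -{2}sz ltnS.
  rewrite (d_min v p) // andbT.
  have [q [qth qlst] <-] := dP v.
  by apply: (d_min u (v :: q)) => //=; rewrite euv.
pose par u := odflt o [pick v | e u v && (d u == (d v).+1)].
suff H u : u != o -> e u (par u) /\ d u = (d (par u)).+1.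
  exists par, d; split; [by move=> u /H[]|by move=> u /H[]|].
  by apply/eqP; rewrite -leqn0; apply: (d_min o [::]).
move=> /step[v euv dv]; rewrite /par; case: pickP => [v' /andP[? /eqP]|/(_ v)] //.
by rewrite euv dv eqxx.
Qed.

Lemma injection_of_card (A B : finType) (a0 : A) : #|A| <= #|B| ->
  exists (f : A -> B) (g : B -> A), cancel f g.
Proof.
move=> AB; pose f a : B := enum_val (widen_ord AB (enum_rank a)).
exists f, (fun y => odflt a0 [pick a | f a == y]) => a.
case: pickP => [a' /eqP/enum_val_inj/(congr1 val)/= E|/(_ a)]; last by rewrite eqxx.
by apply: enum_rank_inj; apply: val_inj.
Qed.

Section TreeProtocol.
Variables (R : realType) (n m M q L : nat) (e : rel 'I_m) (o : 'I_m).
Variables (par : 'I_m -> 'I_m) (d : 'I_m -> nat).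
Hypothesis epar : forall u, u != o -> e u (par u).
Hypothesis dpar : forall u, u != o -> d u = (d (par u)).+1.
Local Notation input := {ffun 'I_n -> 'I_M.+1}.
Variables (Omega Msg : finType) (msg0 : Msg).
Hypotheses (cardOmega : #|Omega| = 2 ^ q) (cardMsg : #|Msg| <= 2 ^ L).
Variable F : 'I_m -> input -> Omega -> ('I_m -> Msg) -> Msg.
Hypothesis Fext : forall v x w g h,
  (forall c, child o par v c -> g c = h c) -> F v x w g = F v x w h.
Variable out : Omega -> Msg -> R.

Let D := \max_u d u.
Let dD u : d u <= D. Proof. exact: leq_bigmax. Qed.

Variables (enc : Msg -> L.-tuple bool) (dec : L.-tuple bool -> Msg).
Hypothesis encK : cancel enc dec.
Variable draw : q.-tuple bool -> Omega.
Hypothesis draw_inj : injective draw.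

Definition tree_decode (s : bitseq) : Msg := dec (insubd (enc msg0) s).

Definition tree_value u (x : input) w (h : seq (inbox m)) : Msg :=
  F u x (draw w) (fun c => tree_decode (last [ffun=> [::]] h c)).

(* A vertex of depth [d u] speaks in round [D - d u] only, so that the messages of all
   children of a vertex arrive together in the round before it speaks. *)
Definition tree_send u (x : input) w (h : seq (inbox m)) v : bitseq :=
  if [&& u != o, v == par u & size h + d u == D]
  then tval (enc (tree_value u x w h)) else [::].

Definition tree_protocol : protocol R m n M :=
  @Protocol R m n M q D tree_send (fun x w h => out (draw w) (tree_value o x w h)).

Local Notation P := tree_protocol.
Implicit Types (X : inputs m n M) (w : q.-tuple bool).

Lemma size_history X w t v : size (history (P := P) X w t v) = t.
Proof. by elim: t => //= t IH; rewrite size_rcons IH. Qed.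

Lemma tree_messageE X w t u v : message (P := P) X w t u v =
  if [&& u != o, v == par u & t + d u == D]
  then tval (enc (tree_value u (X u) w (history (P := P) X w t u))) else [::].
Proof. by rewrite /message /= /tree_send size_history. Qed.

Lemma tree_along_edges : along_edges P e.
Proof.
move=> X w t u v _ uv; rewrite tree_messageE; case: ifP => // /and3P[uo /eqP vE _].
by rewrite vE epar in uv.
Qed.

Lemma tree_self_delimiting : self_delimiting P.
Proof.
move=> X X' w t u v _ _ _; rewrite !tree_messageE; case: ifP => // _.
by rewrite prefixE size_tuple take_oversize ?size_tuple // => /eqP.
Qed.

Lemma sum_tree_messages X w u v :
  \sum_(t < D) size (message (P := P) X w t u v) <= L.
Proof.
apply: leq_trans (_ : \sum_(t < D) (t == D - d u :> nat) * L <= _).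
  apply: leq_sum => t _; rewrite tree_messageE; case: ifP => // /and3P[_ _ /eqP E].
  by rewrite size_tuple -(canRL (addnK (d u)) E) eqxx mul1n.
rewrite -big_distrl /= -[leqRHS]mul1n leq_mul2r; apply/orP; right.
have [dlt|dge] := ltnP (D - d u) D.
  rewrite (bigD1 (Ordinal dlt)) //= eqxx big1 // => i; rewrite -val_eqE /= => /negPf ->.
  by [].
by rewrite big1 // => i _; rewrite (ltn_eqF (leq_trans (ltn_ord i) dge)).
Qed.

Lemma tree_communication : max_communication P e <= 2 * L.
Proof.
apply/bigmax_leqP => X _; apply/bigmax_leqP => w _; apply/bigmax_leqP => uv _.
by rewrite /edge_bits big_split /= mul2n -addnn leq_add // sum_tree_messages.
Qed.

Variable V : Omega -> inputs m n M -> 'I_m -> Msg.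
Hypothesis VE : forall z X v, V z X v = F v (X v) z (V z X).

Lemma tree_valueE X w v t : t + d v = D ->
  tree_value v (X v) w (history (P := P) X w t v) = V (draw w) X v.
Proof.
elim/(tree_ind dpar dD): v t => v IH t tD; rewrite VE /tree_value.
apply: Fext => c cv; have dc := child_depth dpar cv.
have := dD c; rewrite dc => dvD.
case: t tD => [|t] tD; first by move: dvD; rewrite -tD add0n ltnn.
rewrite /= last_rcons ffunE.
have -> : tree_send c (X c) w (history (P := P) X w t c) v = message (P := P) X w t c v by [].
have tD' : t + d c = D by rewrite dc addnS -addSn.
rewrite tree_messageE tD' eqxx; case/andP: (cv) => -> /eqP ->; rewrite eqxx /=.
by rewrite /tree_decode valKd encK IH.
Qed.

Lemma tree_success (eps : R) X (do0 : d o = 0) :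
  success_prob P o eps X =
  Pr R (fun z => `|out z (V z X o) - entropy (aggregate R X)| <= eps)%R.
Proof.
have draw_bij : bijective draw.
  by apply: inj_card_bij => //; rewrite cardOmega card_tuple card_bool.
rewrite Pr_card /success_prob cardOmega natrX; congr (_ / _)%R.
congr (_%:R)%R.
have -> : [set w : (coins P).-tuple bool | (`|output o X w - entropy (aggregate R X)| <= eps)%R]
  = draw @^-1: [set z | (`|out z (V z X o) - entropy (aggregate R X)| <= eps)%R].
  apply/setP => w; rewrite !inE /output /= tree_valueE //.
  by rewrite do0 addn0.
by apply: on_card_preimset; case: draw_bij => g gK Kg; exists g => x _; [exact: gK|exact: Kg].
Qed.

End TreeProtocol.

Theorem tree_protocol_exists (R : realType) (n m M q L : nat) (e : rel 'I_m) (o : 'I_m)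
    (par : 'I_m -> 'I_m) (d : 'I_m -> nat)
    (Omega Msg : finType) (msg0 : Msg)
    (F : 'I_m -> {ffun 'I_n -> 'I_M.+1} -> Omega -> ('I_m -> Msg) -> Msg)
    (out : Omega -> Msg -> R) (V : Omega -> inputs m n M -> 'I_m -> Msg) :
  (forall u, u != o -> e u (par u)) ->
  (forall u, u != o -> d u = (d (par u)).+1) -> d o = 0 ->
  #|Omega| = 2 ^ q -> #|Msg| <= 2 ^ L ->
  (forall v x w g h, (forall c, child o par v c -> g c = h c) ->
     F v x w g = F v x w h) ->
  (forall w X v, V w X v = F v (X v) w (V w X)) ->
  exists P : protocol R m n M,
    [/\ along_edges P e, self_delimiting P, max_communication P e <= 2 * L &
      forall (eps : R) X, success_prob P o eps X =
        Pr R (fun w => `|out w (V w X o) - entropy (aggregate R X)| <= eps)%R].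
Proof.
move=> epar dpar do0 cO cM Fext VE.
have [|enc [dec encK]] := @injection_of_card Msg (L.-tuple bool) msg0.
  by rewrite card_tuple card_bool.
have [w0 _|E] := pickP (@predT Omega); last first.
  by move: cO; rewrite (eq_card0 E) => /esym/eqP; rewrite expn_eq0.
have [|draw [g drawK]] := @injection_of_card (q.-tuple bool) Omega [tuple of nseq q false].
  by rewrite card_tuple card_bool cO.
exists (@tree_protocol R n m M q L o par d Omega Msg msg0 F out enc dec draw); split.
- exact: tree_along_edges.
- exact: tree_self_delimiting.
- exact: tree_communication.
- by move=> eps X; apply: tree_success => //; exact: can_inj drawK.
Qed.

Local Open Scope ring_scope.

(** * From approximate counters to the entropy *)

Section Perturbation.
Variable R : realType.
Implicit Types (y z : R).

Lemma expRN_lip y z : y <= z -> expR (- y) - expR (- z) <= (z - y) * expR (- y).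
Proof.
move=> yz; have -> : expR (- z) = expR (- y) * expR (- (z - y)).
  by rewrite -expRD; congr expR; ring.
have := expR_ge1Dx (- (z - y)); have := expR_ge0 (- y).
by move=> H1 H2; have := ler_wpM2l H1 H2; lra.
Qed.

Lemma expRN_lip_norm y z : `|expR (- y) - expR (- z)| <= `|y - z| * expR (- Num.min y z).
Proof.
have [yz|zy] := leP y z.
  have ? : expR (- z) <= expR (- y) by rewrite ler_expR lerN2.
  by rewrite ger0_norm ?subr_ge0 // distrC ger0_norm ?subr_ge0 // expRN_lip.
have ? : expR (- y) <= expR (- z) by rewrite ler_expR lerN2 ltW.
rewrite distrC ger0_norm ?subr_ge0 // ger0_norm ?subr_ge0 ?(ltW zy) //.
by rewrite expRN_lip // ltW.
Qed.

Lemma exp_perturb (y z zeta L : R) : 0 <= y -> 0 <= zeta <= 2^-1 -> 0 <= L ->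
  zeta * L <= 2^-1 -> `|z - y| <= zeta * y ->
  `|expR (- z) - expR (- y)| <= 2 * (zeta * L) * expR (- y) + 4 * zeta * expR (- (L / 4)).
Proof.
move=> y0 /andP[t0 t2] L0 tL zy.
have e0 x : 0 <= expR x :> R by exact: expR_ge0.
have [yL|yL] := leP y L.
  apply: le_trans (_ : 2 * (zeta * L) * expR (- y) <= _); last first.
    by rewrite lerDl !mulr_ge0.
  have zyL : `|z - y| <= zeta * L by apply: le_trans zy _; rewrite ler_wpM2l.
  set t := zeta * L in tL zyL *.
  have -> : expR (- z) = expR (- y) * expR (y - z) by rewrite -expRD; congr expR; ring.
  have -> : expR (- y) * expR (y - z) - expR (- y) = expR (- y) * (expR (y - z) - 1) by ring.
  rewrite normrM ger0_norm // mulrC ler_wpM2r //.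
  move: zyL; rewrite distrC ler_norml => /andP[lo hi].
  have := expR_ge1Dx (y - z); rewrite ler_norml => H; apply/andP; split; first lra.
  have tp : 0 <= t by lra.
  have : expR (y - z) <= (1 - t)^-1.
    by apply: le_trans (_ : expR t <= _); [rewrite ler_expR|apply: expR_le_inv; lra].
  have : (1 - t)^-1 <= 1 + 2 * t by rewrite -div1r ler_pdivrMr; nra.
  by lra.
apply: le_trans (_ : 4 * zeta * expR (- (L / 4)) <= _); last first.
  by rewrite lerDr !mulr_ge0.
apply: le_trans (expRN_lip_norm _ _) _.
have hm : y / 2 <= Num.min z y.
  rewrite le_min; apply/andP; split; last lra.
  move: zy; rewrite ler_norml => /andP[lo _].
  have : zeta * y <= 2^-1 * y by rewrite ler_wpM2r.
  by lra.
apply: le_trans (_ : zeta * y * expR (- (y / 2)) <= _).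
  by apply: ler_pM => //; rewrite ler_expR lerN2.
have -> : expR (- (y / 2)) = expR (- (y / 4)) * expR (- (y / 4)).
  by rewrite -expRD; congr expR; field.
have h4 : y * expR (- (y / 4)) <= 4.
  rewrite expRN ler_pdivrMr ?expR_gt0 //.
  by have := expR_ge1Dx (y / 4); lra.
have -> : zeta * y * (expR (- (y / 4)) * expR (- (y / 4))) =
  zeta * ((y * expR (- (y / 4))) * expR (- (y / 4))) by ring.
have -> : 4 * zeta * expR (- (L / 4)) = zeta * (4 * expR (- (L / 4))) by ring.
rewrite ler_wpM2l // ler_pM ?mulr_ge0 // ler_expR lerN2; lra.
Qed.

Lemma ratio_perturb (C C' S S' eta : R) : 0 <= C -> 0 < S -> 0 <= eta <= 2^-1 ->
  `|C' - C| <= eta * C -> `|S' - S| <= eta * S ->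
  `|C' / S' - C / S| <= 4 * eta * (C / S).
Proof.
move=> C0 S0 /andP[h0 h2]; rewrite !ler_norml => /andP[c1 c2] /andP[s1 s2].
have hS : eta * S <= 2^-1 * S by rewrite ler_wpM2r // ltW.
have S'0 : 0 < S' by lra.
have -> : C' / S' - C / S = (C' * S - C * S') / (S' * S) by field; rewrite !lt0r_neq0.
have -> : 4 * eta * (C / S) = (4 * eta * C * S') / (S' * S) by field; rewrite !lt0r_neq0.
have P : 0 < (S' * S)^-1 by rewrite invr_gt0 mulr_gt0.
rewrite -mulNr !ler_pM2r //.
have a1 : C' * S <= (1 + eta) * C * S by rewrite ler_pM2r //; lra.
have a2 : (1 - eta) * C * S <= C' * S by rewrite ler_pM2r //; lra.
have b1 : C * S' <= C * ((1 + eta) * S) by rewrite ler_wpM2l //; lra.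
have b2 : C * ((1 - eta) * S) <= C * S' by rewrite ler_wpM2l //; lra.
have CS : 0 <= C * S by rewrite mulr_ge0 // ltW.
have b3 : eta * (C * ((1 - eta) * S)) <= eta * (C * S') by rewrite ler_wpM2l.
have b4 : eta * (2^-1 * (C * S)) <= eta * (C * ((1 - eta) * S)).
  by rewrite ler_wpM2l //; have := ler_wpM2r CS h2; lra.
by apply/andP; split; lra.
Qed.

Lemma ln_perturb (h D eps : R) : 0 < eps < 1 ->
  `|D - expR (- h)| <= eps / 2 * expR (- h) -> `|- ln D - h| <= eps.
Proof.
move=> /andP[e0 e1]; rewrite ler_norml => /andP[lo hi].
have E0 : 0 < expR (- h) by exact: expR_gt0.
have D0 : 0 < D by nra.
have up : D <= expR (eps - h).
  have -> : eps - h = - h + eps by ring.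
  rewrite expRD; have := expR_ge1Dx eps => H.
  by have := ler_wpM2l (ltW E0) H; nra.
have dn : expR (- eps - h) <= D.
  have -> : - eps - h = - h + - eps by ring.
  have H : expR (- eps) <= 1 - eps / 2.
    rewrite expRN -div1r ler_pdivrMr ?expR_gt0 //.
    have := expR_ge1Dx eps => H.
    have H2 : 0 <= 1 - eps / 2 by lra.
    by have := ler_wpM2l H2 H; nra.
  by rewrite expRD; have := ler_wpM2l (ltW E0) H; lra.
have lD : expR (ln D) = D by rewrite lnK ?posrE.
have {}up : ln D <= eps - h by rewrite -ler_expR lD.
have {}dn : - eps - h <= ln D by rewrite -ler_expR lD.
by rewrite ler_norml; apply/andP; split; lra.
Qed.

End Perturbation.

Section SketchMean.
Variables (R : realType) (n N K k : nat) (x : 'I_n -> nat).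
Let S := (\sum_i x i)%N.
Hypotheses (S0 : (0 < S)%N) (K0 : (0 < K)%N) (N4 : (4 <= N)%N) (k0 : (0 < k)%N).
Local Notation seed := {ffun 'I_n * 'I_N -> 'I_K}.
Local Notation H := (shannon R x).

Lemma shannon_le : H <= ln n%:R.
Proof.
have n0 : (0 < n)%N.
  by move: S0; rewrite /S; case: (n) x => // y; rewrite big_ord0.
have np : 0 < n%:R :> R by rewrite ltr0n.
rewrite -subr_le0.
have -> : H - ln n%:R = \sum_i 
    (prob R x i * ln (1 / prob R x i) - prob R x i * ln n%:R).
  by rewrite sumrB -mulr_suml prob_sum // mul1r.
apply: le_trans (_ : \sum_i (n%:R^-1 - prob R x i) <= _); last first.
  by rewrite sumrB prob_sum // sumr_const card_ord -[_ *+ n]mulr_natl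
       divff ?subrr // lt0r_neq0.
apply: ler_sum => i _; have [->|p0] := eqVneq (prob R x i) 0.
  by rewrite !mul0r !subr0 invr_ge0 ltW.
have : 0 < prob R x i by rewrite lt_def p0 prob_ge0.
move: (prob R x i) => p pp; rewrite div1r lnV ?posrE //.
have Hp := @ln_sublinear R.
have := @le_ln1Dx R ((p * n%:R)^-1 - 1).
rewrite addrCA subrr addr0 lnV ?posrE ?mulr_gt0 // lnM ?posrE // => Hl.
have {}Hl : - (ln p + ln n%:R) <= (p * n%:R)^-1 - 1.
  by apply: Hl; rewrite ltrBrDl subrr invr_gt0 mulr_gt0.
have -> : n%:R^-1 - p = p * ((p * n%:R)^-1 - 1) by field; rewrite !lt0r_neq0.
by have := ler_wpM2l (ltW pp) Hl; lra.
Qed.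

Definition sketch_mean (a : {ffun 'I_k -> seed}) : R :=
  (\sum_j N%:R * sketch_exp x 1 (a j)) / k%:R.

Lemma sketch_mean_concentration (eps : R) : 0 < eps < 1 ->
  208 * Num.sqrt (2 / N%:R) + 4 * n%:R * N%:R * (1 + 2 * N%:R * S%:R) / K%:R <= eps / 16 ->
  Pr R (fun a => eps / 4 * expR (- H) < `|sketch_mean a - expR (- H)|)
    <= 512 / (k%:R * eps ^+ 2).
Proof.
move=> /andP[e0 e1] bias; set h := expR (- H).
have hp : 0 < h by exact: expR_gt0.
have Np : 0 < N%:R :> R by rewrite ltr0n; apply: leq_trans N4.
have kp : 0 < k%:R :> R by rewrite ltr0n.
pose f (s : seed) : R := N%:R * sketch_exp x 1 s.
have card_seed : (0 < #|{: seed}|)%N by rewrite card_ffun expn_gt0 card_ord K0.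
have nu2 : eps / 16 <= 2^-1 by lra.
have th1 : 1 <= (1 : R) <= 2 by apply/andP; split; lra.
have th2 : 1 <= (2 : R) <= 2 by apply/andP; split; lra.
have [l1 u1] := Ex_sketch_approx S0 K0 N4 th1 nu2 bias.
have [_ u2] := Ex_sketch_approx S0 K0 N4 th2 nu2 bias.
have T1 : N%:R * expR (1 * (- H + ln 1 - ln N%:R)) = h.
  by rewrite mul1r ln1 addr0 expRB lnK ?posrE // mulrC divfK // lt0r_neq0.
have T2 : N%:R ^+ 2 * expR (2 * (- H + ln 2 - ln N%:R)) = 4 * h ^+ 2.
  rewrite (expRM_natl 2) expRB expRD !lnK ?posrE // -/h; field.
  by rewrite lt0r_neq0.
set mu := Ex f.
have muE : mu = N%:R * Ex (@sketch_exp R n N K x 1) by rewrite -ExZ.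
have e16 : expR (eps / 16) <= 1 + eps / 8.
  apply: le_trans (expR_le_inv _) _; first lra.
  by rewrite -div1r ler_pdivrMr; nra.
have e16' : 1 - eps / 8 <= expR (- 2 * (eps / 16)).
  by apply: le_trans (expR_ge1Dx _); lra.
have mu_h : `|mu - h| <= eps / 8 * h.
  have lo : h * (1 - eps / 8) <= mu.
    rewrite muE; apply: le_trans (_ : N%:R *
      (expR (1 * (- H + ln 1 - ln N%:R)) * expR (- 2 * (eps / 16))) <= _).
      by rewrite mulrA T1 ler_wpM2l // ltW.
    by rewrite ler_wpM2l // ltW.
  have hi : mu <= h * (1 + eps / 8).
    rewrite muE; apply: le_trans (_ : N%:R *
      (expR (1 * (- H + ln 1 - ln N%:R)) * expR (eps / 16)) <= _).
      by rewrite ler_wpM2l // ltW.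
    by rewrite mulrA T1 ler_wpM2l // ltW.
  by rewrite ler_norml; apply/andP; split; lra.
have f2 : Ex (fun s => f s ^+ 2) <= 8 * h ^+ 2.
  have -> : Ex (fun s => f s ^+ 2) = N%:R ^+ 2 * Ex (@sketch_exp R n N K x 2).
    rewrite -ExZ; apply: eq_Ex => s; rewrite /f exprMn; congr (_ * _).
    rewrite /sketch_exp -expRM_natl; congr expR; ring.
  apply: le_trans (_ : N%:R ^+ 2 * (expR (2 * (- H + ln 2 - ln N%:R)) * expR (eps / 16)) <= _).
    by rewrite ler_wpM2l // sqr_ge0.
  rewrite mulrA T2; have := ler_wpM2l (sqr_ge0 h) e16; have := sqr_ge0 h.
  by nra.
have var : Ex (fun s => (f s - mu) ^+ 2) <= 8 * h ^+ 2.
  apply: le_trans f2.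
  have -> : Ex (fun s => (f s - mu) ^+ 2)
    = Ex (fun s => (f s ^+ 2 + (- 2 * mu) * f s) + mu ^+ 2).
    by apply: eq_Ex => s; ring.
  rewrite ExD ExD ExZ Ex_cst // -/mu.
  by have := sqr_ge0 mu; lra.
apply: le_trans (_ : Pr R (fun a => eps / 8 * h < `|sketch_mean a - mu|) <= _).
  apply: ler_Pr => a H1; have := ler_distD mu (sketch_mean a) h.
  by lra.
apply: le_trans (chebyshev _ _ _) _; first by rewrite mulr_gt0 //; lra.
have E := @Ex_mean_sqr R 'I_k seed f mu card_seed.
rewrite card_ord in E; rewrite /sketch_mean E //.
have q0 : 0 < (eps / 8 * h) ^+ 2 by rewrite exprn_gt0 // mulr_gt0 //; lra.
rewrite ler_pdivrMr //.
apply: le_trans (_ : 8 * h ^+ 2 / k%:R <= _); first by rewrite ler_pM2r ?invr_gt0.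
rewrite le_eqVlt; apply/orP; left; apply/eqP; field.
by rewrite !lt0r_neq0.
Qed.
End SketchMean.

Section EntropyProtocol.
Variables (R : realType) (n m M k N T b Q : nat).
Variables (o : 'I_m) (par : 'I_m -> 'I_m) (d : 'I_m -> nat).
Hypothesis dpar : forall u, u != o -> d u = (d (par u)).+1.

Local Notation input := {ffun 'I_n -> 'I_M.+1}.
Local Notation seeds := {ffun 'I_k -> {ffun 'I_n * 'I_N -> 'I_(2 ^ T)}}.
Local Notation coin := {ffun 'I_m -> 'I_(2 ^ Q)}.
Local Notation coins := {ffun option 'I_k -> coin}.
Local Notation code := ('I_Q.+1 * 'I_(2 ^ b.+1).+1)%type.
Local Notation msg := {ffun option 'I_k -> code}.

(* The counter [None] tracks the total mass, the counter [Some i] the [i]-th sketch. *)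
Definition contrib (x : 'I_n -> nat) (a : seeds) (j : option 'I_k) : nat :=
  if j is Some i then sketch x (a i) else (\sum_i x i)%N.

(* Junk value [(0, 0)] for numbers from [2 ^ (b.+1 + Q)] on. *)
Definition encode (r : nat) : code :=
  odflt (ord0, ord0) [pick p : code | float_val p == r].

Definition node (v : 'I_m) (x : input) (w : seeds * coins) (g : 'I_m -> msg) : msg :=
  [ffun j => encode (rnd b (contrib (fun i => x i) w.1 j +
     \sum_(c | child o par v c) float_val (g c j))%N (w.2 j v))].

Definition estimate (y : msg) : R :=
  - ln ((\sum_(j < k) N%:R *
     expR (- ((float_val (y (Some j)))%:R / ((float_val (y None))%:R * N%:R)))) / k%:R).

Let dD u : (d u <= \max_v d v)%N. Proof. exact: leq_bigmax. Qed.

Definition tree_msg (w : seeds * coins) (X : inputs m n M) : 'I_m -> msg :=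
  tree_fold d (\max_v d v) [ffun=> (ord0, ord0)] (fun v => node v (X v) w).

Definition counter (h : 'I_m -> nat) (c : coin) : 'I_m -> nat :=
  tree_fold d (\max_v d v) 0%N
    (fun v g => rnd b (h v + \sum_(u | child o par v u) g u)%N (c v)).

Lemma node_ext v x w g h : (forall c, child o par v c -> g c = h c) ->
  node v x w g = node v x w h.
Proof.
move=> gh; apply/ffunP => j; rewrite !ffunE.
have -> : (\sum_(c | child o par v c) float_val (g c j)
           = \sum_(c | child o par v c) float_val (h c j))%N.
  by apply: eq_bigr => c /gh ->.
by [].
Qed.

Lemma tree_msgE w X v : tree_msg w X v = node v (X v) w (tree_msg w X).
Proof. by apply: (tree_foldE dpar dD) => u g h gh; exact: node_ext. Qed.

Lemma counterE h c v :
  counter h c v = rnd b (merged o par h (counter h) c v) (c v).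
Proof.
rewrite /merged {1}/counter (tree_foldE dpar dD) // => u g g' gg'.
by congr (rnd _ (_ + _) _); apply: eq_bigr => e /gg' ->.
Qed.

Lemma encodeK r : grid b Q r -> (r < 2 ^ (b.+1 + Q))%N -> float_val (encode r) = r.
Proof.
move=> gr rlt; have [p pr] := grid_float gr rlt; rewrite /encode.
by case: pickP => [q /eqP //|/(_ p)]; rewrite pr eqxx.
Qed.

Lemma tree_msg_counter (w : seeds * coins) (X : inputs m n M) :
  (forall j v, counter (fun u => contrib (fun i => X u i) w.1 j) (w.2 j) v
     < 2 ^ (b.+1 + Q))%N ->
  forall v j, float_val (tree_msg w X v j)
    = counter (fun u => contrib (fun i => X u i) w.1 j) (w.2 j) v.
Proof.
move=> small; elim/(tree_ind dpar dD) => v IH j; rewrite tree_msgE ffunE.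
have := small j v; rewrite counterE => sm.
rewrite -[in RHS](encodeK _ sm); last exact: rnd_grid.
rewrite /merged.
have -> : (\sum_(c | child o par v c) float_val (tree_msg w X c j)
           = \sum_(c | child o par v c)
               counter (fun u => contrib (fun i => X u i) w.1 j) (w.2 j) c)%N.
  by apply: eq_bigr => c cv; rewrite IH.
by [].
Qed.

Variable X : inputs m n M.
Definition total_input (i : 'I_n) : nat := (\sum_u X u i)%N.
Let S := (\sum_i total_input i)%N.

Lemma contrib_total a j :
  (\sum_u contrib (fun i => X u i) a j = contrib total_input a j)%N.
Proof.
case: j => [j|] /=; last by rewrite exchange_big.
rewrite /sketch exchange_big /=; apply: eq_bigr => i _.
by rewrite -big_distrl.
Qed.

Lemma total_le : (S <= n * (m * M))%N.
Proof.
rewrite /S /total_input.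
apply: leq_trans (_ : \sum_(i < n) \sum_(u < m) M <= _)%N.
  by apply: leq_sum => i _; apply: leq_sum => u _; rewrite -ltnS ltn_ord.
by rewrite !sum_nat_const !card_ord.
Qed.

Lemma weight_bounds (s : {ffun 'I_n * 'I_N -> 'I_(2 ^ T)}) i :
  (N <= weight s i <= N * 2 ^ T)%N.
Proof.
rewrite /weight; apply/andP; split.
  apply: leq_trans (_ : \sum_(l < N) 1 <= _)%N; first by rewrite sum1_card card_ord.
  by apply: leq_sum => l _; rewrite /pareto divn_gt0.
apply: leq_trans (_ : \sum_(l < N) 2 ^ T <= _)%N.
  by apply: leq_sum => l _; exact: pareto_le.
by rewrite sum_nat_const card_ord.
Qed.

Lemma contrib_bounds a j : (0 < N)%N ->
  (S <= contrib total_input a j <= S * (N * 2 ^ T))%N.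
Proof.
move=> N0; case: j => [j|] /=; last by rewrite leqnn leq_pmulr // muln_gt0 N0 expn_gt0.
rewrite /sketch /S; apply/andP; split.
  apply: leq_sum => i _; have /andP[H _] := weight_bounds (a j) i.
  by rewrite leq_pmulr // (leq_trans N0).
rewrite big_distrl /=; apply: leq_sum => i _.
by have /andP[_ H] := weight_bounds (a j) i; rewrite leq_mul2l H orbT.
Qed.

Lemma entropy_aggregate : entropy (aggregate R X) = shannon R total_input.
Proof.
have E i : `|aggregate R X 0 i| = (total_input i)%:R.
  by rewrite mxE ger0_norm ?sumr_ge0 // /total_input natr_sum.
rewrite /entropy /shannon /prob; apply: eq_bigr => i _.
have -> : \sum_j `|aggregate R X 0 j| = S%:R.
  by rewrite /S natr_sum; apply: eq_bigr.
by rewrite E.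
Qed.

Lemma aggregate_neq0 : aggregate R X != 0 -> (0 < S)%N.
Proof.
rewrite lt0n; apply: contra => /eqP S0; apply/eqP/rowP => i.
rewrite !mxE -natr_sum -/(total_input i).
have : (total_input i <= S)%N by rewrite /S (bigD1 i) //= leq_addr.
by rewrite S0 leqn0 => /eqP ->.
Qed.

Variables (eps delta : R).
Let L : R := 4 * ln (N%:R * n%:R).
Let eta : R := eps / (256 * (1 + L)).

Lemma estimate_accurate (a : seeds) (y : msg) :
  0 < eps < 1 -> (0 < S)%N -> (4 <= N)%N -> (0 < k)%N ->
  `|sketch_mean R total_input a - expR (- shannon R total_input)|
     <= eps / 4 * expR (- shannon R total_input) ->
  (forall j, `|(float_val (y j))%:R - (contrib total_input a j)%:R|
     <= eta * (contrib total_input a j)%:R) ->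
  `|estimate y - entropy (aggregate R X)| <= eps.
Proof.
move=> /[dup] epsP /andP[e0 e1] S0 N4 k0 mean_ok cnt_ok.
rewrite entropy_aggregate; apply: (ln_perturb epsP).
set H := shannon R total_input; set h := expR (- H).
have {}mean_ok : `|sketch_mean R total_input a - h| <= eps / 4 * h by exact: mean_ok.
have hp : 0 < h by exact: expR_gt0.
have Np : 0 < N%:R :> R by rewrite ltr0n; apply: leq_trans N4.
have kp : 0 < k%:R :> R by rewrite ltr0n.
have Sp : 0 < S%:R :> R by rewrite ltr0n.
have n0 : (0 < n)%N.
  by rewrite lt0n; apply: contraTneq S0 => n0; rewrite /S big1 // => i _;
  suff : (i < 0)%N by []; rewrite -[X in (_ < X)%N]n0.
have np : 0 < n%:R :> R by rewrite ltr0n.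
have L0 : 0 <= L.
  rewrite /L mulr_ge0 // ln_ge0 // -natrM ler1n muln_gt0 n0 andbT.
  exact: leq_trans N4.
pose zeta := 4 * eta.
have L1 : 0 < 1 + L by lra.
have zE : zeta * (1 + L) = eps / 64 by rewrite /zeta /eta; field; lra.
have z0 : 0 <= zeta by rewrite /zeta /eta mulr_ge0 ?divr_ge0 ?mulr_ge0 ?(ltW e0) ?(ltW L1).
have zL0 : 0 <= zeta * L by rewrite mulr_ge0.
have zL : zeta * L <= eps / 64 by lra.
have z1 : zeta <= eps / 64 by lra.
have eta0 : 0 <= eta <= 2^-1 by rewrite /zeta in z0 z1; apply/andP; split; lra.
have eL : expR (- (L / 4)) = (N%:R * n%:R)^-1.
  have -> : - (L / 4) = - ln (N%:R * n%:R) by rewrite /L; field.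
  by rewrite expRN lnK // posrE mulr_gt0.
have Nh : N%:R * expR (- (L / 4)) <= h.
  rewrite eL invfM mulrA divff ?lt0r_neq0 // mul1r.
  rewrite /h expRN lef_pV2 ?posrE ?expR_gt0 //.
  by rewrite -[leRHS]lnK ?posrE // ler_expR shannon_le.
set D' := _ / k%:R.
suff dD' : `|D' - sketch_mean R total_input a| <= eps / 4 * h.
  have := ler_distD (sketch_mean R total_input a) D' h.
  by lra.
have term j : `|N%:R * expR (- ((float_val (y (Some j)))%:R /
      ((float_val (y None))%:R * N%:R)))
    - N%:R * @sketch_exp R n N (2 ^ T) total_input 1 (a j)|
   <= 2 * (zeta * L) * (N%:R * @sketch_exp R n N (2 ^ T) total_input 1 (a j)) + 4 * zeta * h.
  rewrite -mulrBr normrM ger0_norm ?(ltW Np) //.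
  have -> : @sketch_exp R n N (2 ^ T) total_input 1 (a j) =
    expR (- ((contrib total_input a (Some j))%:R / S%:R / N%:R)).
    by rewrite /sketch_exp /=; congr expR; field; rewrite !lt0r_neq0.
  have -> : (float_val (y (Some j)))%:R / ((float_val (y None))%:R * N%:R) =
    (float_val (y (Some j)))%:R / (float_val (y None))%:R / N%:R :> R by rewrite invfM mulrA.
  set q' := (float_val _)%:R / _ / N%:R; set q := (contrib _ _ _)%:R / _ / N%:R.
  have q0 : 0 <= q by rewrite /q !divr_ge0 ?ler0n.
  have qq : `|q' - q| <= zeta * q.
    rewrite /q' /q -mulrBl normrM (ger0_norm (_ : 0 <= N%:R^-1)) ?invr_ge0 ?(ltW Np) //.
    rewrite mulrA ler_pM2r ?invr_gt0 //.
    exact: ratio_perturb (ler0n _ _) Sp eta0 (cnt_ok (Some j)) (cnt_ok None).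
  have zz : 0 <= zeta <= 2^-1 by rewrite z0 /=; lra.
  have zl : zeta * L <= 2^-1 by lra.
  have := exp_perturb q0 zz L0 zl qq.
  move=> E; have := ler_wpM2l (ltW Np) E; have := ler_wpM2l z0 Nh; lra.
have sum_term : `|D' - sketch_mean R total_input a| <=
   2 * (zeta * L) * sketch_mean R total_input a + 4 * zeta * h.
  rewrite /D' /sketch_mean -mulrBl -sumrB normrM.
  rewrite (ger0_norm (_ : 0 <= k%:R^-1)) ?invr_ge0 ?(ltW kp) //.
  rewrite ler_pdivrMr //; apply: le_trans (ler_norm_sum _ _ _) _.
  apply: le_trans (ler_sum _ (fun j _ => term j)) _.
  rewrite big_split /= -mulr_sumr sumr_const card_ord -[_ *+ k]mulr_natr.
  rewrite le_eqVlt; apply/orP; left; apply/eqP; field.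
  by rewrite lt0r_neq0.
apply: le_trans sum_term _.
move: mean_ok; rewrite ler_norml => /andP[_ hi].
have m2 : sketch_mean R total_input a <= 2 * h by nra.
have := ler_wpM2l zL0 m2; have := ler_wpM2r (ltW hp) zL; have := ler_wpM2r (ltW hp) z1.
by have := mulr_gt0 e0 hp; lra.
Qed.

Lemma Pr_inaccurate_counter (a : seeds) (j : option 'I_k) :
  0 < eps -> (0 < S)%N -> (0 < N)%N -> (1 <= b)%N ->
  Pr R (fun c : coin => eta * (contrib total_input a j)%:R <
     `|(counter (fun u => contrib (fun i => X u i) a j) c o)%:R
       - (contrib total_input a j)%:R|)
  <= 2 / (2 ^ b)%:R / eta ^+ 2.
Proof.
move=> e0 S0 N0 b1.
have n0 : (0 < n)%N.
  rewrite lt0n; apply: contraTneq S0 => n0; rewrite /S big1 // => i _.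
  suff : (i < 0)%N by []; rewrite -[X in (_ < X)%N]n0; exact: ltn_ord.
have L0 : 0 <= L.
  by rewrite /L mulr_ge0 // ln_ge0 // -natrM ler1n muln_gt0 n0 N0.
have eta0 : 0 < eta by apply: divr_gt0 => //; apply: mulr_gt0; lra.
have C0 : 0 < (contrib total_input a j)%:R :> R.
  by rewrite ltr0n (leq_trans S0) //; have /andP[] := contrib_bounds a j N0.
apply: le_trans (chebyshev _ _ (mulr_gt0 eta0 C0)) _.
rewrite ler_pdivrMr ?(exprn_gt0 _ (mulr_gt0 eta0 C0)) //.
have E := @counter_variance m o par d _ dpar dD R b Q
  (fun u => contrib (fun i => X u i) a j) _ (counterE _) b1.
rewrite contrib_total in E; apply: le_trans E _.
have -> : (eta * (contrib total_input a j)%:R) ^+ 2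
  = eta ^+ 2 * (contrib total_input a j)%:R ^+ 2.
  exact: exprMn.
by rewrite [leRHS]mulrA divfK // expf_neq0 // lt0r_neq0.
Qed.

Lemma Pr_overflow (a : seeds) (j : option 'I_k) (v : 'I_m) : (0 < N)%N ->
  Pr R (fun c : coin => 2 ^ (b.+1 + Q) <=
     counter (fun u => contrib (fun i => X u i) a j) c v)%N
  <= (n * (m * M) * (N * 2 ^ T))%:R / (2 ^ (b.+1 + Q))%:R.
Proof.
move=> N0.
have cap0 : 0 < (2 ^ (b.+1 + Q))%:R :> R by rewrite ltr0n expn_gt0.
pose r (c : coin) : R := (counter (fun u => contrib (fun i => X u i) a j) c v)%:R.
apply: le_trans (_ : Pr R (fun c => (2 ^ (b.+1 + Q))%:R <= r c) <= _).
  by apply: ler_Pr => c; rewrite /r ler_nat.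
apply: le_trans (markov cap0 _) _; first by move=> c; exact: ler0n.
rewrite ler_pM2r ?invr_gt0 //.
have E := @Ex_counter_le m o par d _ dpar dD R b Q
  (fun u => contrib (fun i => X u i) a j) _ (counterE _) v.
apply: le_trans E _; rewrite contrib_total ler_nat.
have /andP[_ H] := contrib_bounds a j N0; apply: leq_trans H _.
by rewrite leq_mul2r total_le orbT.
Qed.

Theorem entropy_protocol_correct :
  0 < eps < 1 -> (4 <= N)%N -> (0 < k)%N -> (1 <= b)%N -> aggregate R X != 0 ->
  208 * Num.sqrt (2 / N%:R) +
    4 * n%:R * N%:R * (1 + 2 * N%:R * (n * (m * M))%:R) / (2 ^ T)%:R <= eps / 16 ->
  512 / (k%:R * eps ^+ 2) <= delta / 3 ->
  k.+1%:R * (2 / (2 ^ b)%:R / eta ^+ 2) <= delta / 3 ->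
  k.+1%:R * (m%:R * ((n * (m * M) * (N * 2 ^ T))%:R / (2 ^ (b.+1 + Q))%:R)) <= delta / 3 ->
  1 - delta <= Pr R (fun w : seeds * coins =>
    `|estimate (tree_msg w X o) - entropy (aggregate R X)| <= eps).
Proof.
move=> /[dup] epsP /andP[e0 e1] N4 k0 b1 X0 bias d1 d2 d3.
have S0 := aggregate_neq0 X0; have N0 : (0 < N)%N by exact: leq_trans N4.
have K0 : (0 < 2 ^ T)%N by rewrite expn_gt0.
pose h := expR (- shannon R total_input).
pose bad1 (a : seeds) := eps / 4 * h < `|sketch_mean R total_input a - h|.
pose cnt (w : seeds * coins) j v :=
  counter (fun u => contrib (fun i => X u i) w.1 j) (w.2 j) v.
pose bad2 (w : seeds * coins) := [exists j, [exists v, (2 ^ (b.+1 + Q) <= cnt w j v)%N]].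
pose bad3 (w : seeds * coins) := [exists j, eta * (contrib total_input w.1 j)%:R <
  `|(cnt w j o)%:R - (contrib total_input w.1 j)%:R|].
have cc : (0 < #|{: coin}|)%N by rewrite card_ffun expn_gt0 card_ord expn_gt0.
have ccs : (0 < #|{: coins}|)%N by rewrite card_ffun expn_gt0 cc.
have cs : (0 < #|{: seeds}|)%N.
  by rewrite card_ffun expn_gt0 card_ffun expn_gt0 card_ord K0.
have cw : (0 < #|{: seeds * coins}|)%N by rewrite card_prod muln_gt0 cs ccs.
have p1 : Pr R (fun w : seeds * coins => bad1 w.1) <= delta / 3.
  rewrite /Pr Ex_pair /=; apply: le_trans d1.
  have nb : 208 * Num.sqrt (2 / N%:R) +
      4 * n%:R * N%:R * (1 + 2 * N%:R * S%:R) / (2 ^ T)%:R <= eps / 16.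
    apply: le_trans bias; rewrite lerD2l ler_pM2r ?invr_gt0 ?ltr0n //.
    rewrite ler_wpM2l ?mulr_ge0 ?ler0n // lerD2l ler_wpM2l ?mulr_ge0 ?ler0n //.
    by rewrite ler_nat total_le.
  have H := @sketch_mean_concentration R n N (2 ^ T) k total_input S0 K0 N4 k0 eps epsP nb.
  apply: le_trans H; apply: le_Ex => a.
  by rewrite Ex_cst.
have p2 : Pr R bad2 <= delta / 3.
  apply: le_trans (Pr_exists _ _) _; apply: le_trans d3.
  have -> : k.+1 = #|{: option 'I_k}| by rewrite card_option card_ord.
  rewrite mulr_natl -sumr_const; apply: ler_sum => j _.
  apply: le_trans (Pr_exists _ _) _.
  rewrite mulr_natl -[X in _ *+ X](card_ord m) -sumr_const; apply: ler_sum => v _.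
  rewrite /Pr Ex_pair -[leRHS](Ex_cst _ cs).
  apply: le_Ex => a /=; rewrite /cnt /=.
  rewrite (@Ex_marginal R _ _ j (fun c : coin => (2 ^ (b.+1 + Q) <=
    counter (fun u => contrib (fun i => X u i) a j) c v)%N%:R)) //.
  exact: Pr_overflow.
have p3 : Pr R bad3 <= delta / 3.
  apply: le_trans (Pr_exists _ _) _; apply: le_trans d2.
  have -> : k.+1 = #|{: option 'I_k}| by rewrite card_option card_ord.
  rewrite mulr_natl -sumr_const; apply: ler_sum => j _.
  rewrite /Pr Ex_pair -[leRHS](Ex_cst _ cs).
  apply: le_Ex => a /=; rewrite /cnt /=.
  rewrite (@Ex_marginal R _ _ j (fun c : coin => (eta * (contrib total_input a j)%:R <
     `|(counter (fun u => contrib (fun i => X u i) a j) c o)%:R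
       - (contrib total_input a j)%:R|)%R%:R)) //.
  exact: Pr_inaccurate_counter.
pose bad w := bad1 w.1 || (bad2 w || bad3 w).
have pbad : Pr R bad <= delta.
  have := Pr_or R (fun w => bad1 w.1) (fun w => bad2 w || bad3 w).
  have := Pr_or R bad2 bad3; rewrite -/(bad _); lra.
apply: le_trans (_ : Pr R (predC bad) <= _).
  by rewrite Pr_predC // lerD2l lerN2.
apply: ler_Pr => w /=; rewrite /bad !negb_or => /and3P[g1 g2 g3].
have small j v : (cnt w j v < 2 ^ (b.+1 + Q))%N.
  rewrite ltnNge; apply: contra g2 => H.
  by apply/existsP; exists j; apply/existsP; exists v.
apply: (@estimate_accurate w.1) => // [|j]; first by rewrite leNgt.
rewrite tree_msg_counter //.
rewrite leNgt; apply: contra g3 => H.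
by apply/existsP; exists j.
Qed.

End EntropyProtocol.

(** * Choice of the parameters *)

Section ParameterChoice.
Variable R : realType.

Lemma nat_ceil (x : R) : 0 <= x -> exists n : nat, x <= n%:R <= x + 1.
Proof.
move=> x0; have ex : exists n, x <= n%:R.
  by exists (Num.bound x); apply: ltW; exact: archi_boundP.
exists (ex_minn ex); case: ex_minnP => -[|n] xn min; rewrite xn /=; first lra.
rewrite -natr1 lerD2r leNgt; apply/negP => /ltW /min.
by rewrite ltnn.
Qed.

Lemma pow2_ceil (x : R) : 1 <= x -> exists t : nat, x <= (2 ^ t)%:R <= 2 * x.
Proof.
move=> x1; have [n /andP[xn _]] := @nat_ceil x (le_trans ler01 x1).
have ex : exists t, x <= (2 ^ t)%:R.
  by exists n; apply: le_trans xn _; rewrite ler_nat ltnW // ltn_expl.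
exists (ex_minn ex); case: ex_minnP => -[|t] xt min; rewrite xt /=.
  by rewrite expn0; lra.
rewrite expnS natrM ler_pM2l // leNgt; apply/negP => /ltW /min.
by rewrite ltnn.
Qed.

Lemma expR1_lt3 : expR 1 < 3 :> R.
Proof.
have -> : 1 = 6%:R * 6^-1 :> R by field.
rewrite expRM_natl (exprM _ 3 2).
have h : expR 6^-1 <= 6 / 5 :> R.
  apply: le_trans (expR_le_inv _) _; first lra.
  by rewrite -[X in X <= _]div1r ler_pdivrMr; lra.
have h0 : 0 <= expR 6^-1 :> R by exact: expR_ge0.
have h3 : expR 6^-1 ^+ 3 <= 45 / 26 :> R.
  apply: le_trans (_ : (6 / 5) ^+ 3 <= _); last lra.
  by rewrite lerXn2r ?nnegrE // divr_ge0.
apply: le_lt_trans (_ : (45 / 26) ^+ 2 < _); last lra.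
by rewrite lerXn2r ?nnegrE ?exprn_ge0 // divr_ge0.
Qed.

Lemma ln3_gt1 : 1 < ln 3 :> R.
Proof. by rewrite -ltr_expR lnK ?posrE // expR1_lt3. Qed.

Lemma ln2_ge : 2^-1 <= ln 2 :> R.
Proof.
rewrite -ler_expR lnK ?posrE //; apply: le_trans (expR_le_inv _) _; first lra.
rewrite -[X in X <= _]div1r ler_pdivrMr; lra.
Qed.

Lemma exponent_le (t : nat) (C W : R) (p : nat) : 1 <= C -> 1 <= W ->
  (2 ^ t)%:R <= C * W ^+ p -> t%:R <= 2 * (ln C + p%:R * ln W).
Proof.
move=> C1 W1 H; have C0 : 0 < C by lra.
have W0 : 0 < W by lra.
have H2 : t%:R * ln 2 <= ln C + p%:R * ln W.
  have : ln ((2 ^ t)%:R) <= ln (C * W ^+ p) :> R.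
    by rewrite ler_ln ?posrE ?ltr0n ?expn_gt0 // mulr_gt0 ?exprn_gt0.
  by rewrite natrX lnM ?posrE ?exprn_gt0 // !lnXn // -[_ *+ t]mulr_natl -[_ *+ p]mulr_natl.
have := ler_wpM2l (ler0n R t) ln2_ge; lra.
Qed.

Variables (a c : nat) (delta : R).
Hypothesis hdelta : 0 < delta < 1.

Lemma parameters_exist : exists2 K : R, 0 < K &
  forall (n m M : nat) (eps : R), (3 <= n)%N -> (0 < m)%N ->
  (m <= a * n ^ c)%N -> (M <= a * n ^ c)%N -> 0 < eps < 1 ->
  exists k N T b Q l : nat,
  [/\ [/\ (4 <= N)%N, (0 < k)%N & (1 <= b)%N],
     [/\ 208 * Num.sqrt (2 / N%:R) +
       4 * n%:R * N%:R * (1 + 2 * N%:R * (n * (m * M))%:R) / (2 ^ T)%:R <= eps / 16,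
     512 / (k%:R * eps ^+ 2) <= delta / 3,
     k.+1%:R * (2 / (2 ^ b)%:R / (eps / (256 * (1 + 4 * ln (N%:R * n%:R)))) ^+ 2)
       <= delta / 3 &
     k.+1%:R * (m%:R * ((n * (m * M) * (N * 2 ^ T))%:R / (2 ^ (b.+1 + Q))%:R))
       <= delta / 3],
     (Q.+1 * (2 ^ b.+1).+1 <= 2 ^ l)%N &
     (2 * (l * k.+1))%:R <= K * (1 / eps ^+ 2 * (ln (ln n%:R) + ln (1 / eps)))].
Proof.
have /andP[d0 d1] := hdelta.
pose K1 : R := 1536 / delta + 2.
pose q : R := 208 * 32.
pose K2 : R := 2 * q ^+ 2 + 1.
pose K3 : R := 4 * (ln K2 + 3).
pose K4 : R := 6 / delta * K1 * (256 * (1 + K3)) ^+ 2.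
pose A2 : R := a%:R ^+ 2.
pose KT : R := 256 * K2 * (1 + 2 * K2 * A2).
pose K5 : R := 3 / delta * K1 * a%:R * A2 * K2 * KT.
pose E : nat := (5 * c + 11)%N.
pose K6 : R := 1 + 2 * (ln (2 * (K5 + 1)) + 2 * E%:R).
pose K7 : R := 12 * K6 * K4.
pose kappa : R := ln (ln 3).
pose K8 : R := 2 * (ln K7 / kappa + 7).
have di0 : 0 <= delta^-1 by rewrite invr_ge0 ltW.
have K1_ge : 2 <= K1 by rewrite /K1 lerDr divr_ge0 ?(ltW d0).
have K2_ge : 1 <= K2 by rewrite /K2 lerDr mulr_ge0 // sqr_ge0.
have lnK2 : 0 <= ln K2 by rewrite ln_ge0.
have K3_ge : 12 <= K3 by rewrite /K3; lra.
have A2_ge : 0 <= A2 by exact: sqr_ge0.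
have KT_ge : 0 <= KT.
  have K20 : 0 <= K2 by apply: le_trans K2_ge.
  have h : 0 <= 1 + 2 * K2 * A2 by rewrite addr_ge0 // mulr_ge0 // mulr_ge0.
  exact: mulr_ge0 (mulr_ge0 (ler0n _ _) K20) h.
have dinv : 1 <= delta^-1 by rewrite invf_ge1 // ltW.
have K4_ge : 1 <= K4.
  have h : 1 <= 256 * (1 + K3).
    apply: mulr_ege1; first by rewrite ler1n.
    by rewrite lerDl; apply: le_trans K3_ge.
  have h6 : 1 <= 6 / delta by apply: mulr_ege1 => //; rewrite ler1n.
  apply: mulr_ege1; last by rewrite expr2; apply: mulr_ege1.
  by apply: mulr_ege1 => //; apply: le_trans K1_ge; rewrite ler1n.
have K5_ge : 0 <= K5.
  have K20 : 0 <= K2 by apply: le_trans K2_ge.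
  have K10 : 0 <= K1 by apply: le_trans K1_ge.
  have h : 0 <= 3 / delta by rewrite mulr_ge0.
  have h2 := mulr_ge0 (mulr_ge0 h K10) (ler0n R a).
  exact: mulr_ge0 (mulr_ge0 (mulr_ge0 h2 A2_ge) K20) KT_ge.
have lnK5 : 0 <= ln (2 * (K5 + 1)) by rewrite ln_ge0 //; lra.
have K6_ge : 1 <= K6.
  by rewrite /K6; have := ler0n R E; lra.
have K7_ge : 1 <= K7.
  rewrite /K7 -[1]mulr1 ler_pM //; nra.
have kap : 0 < kappa by rewrite /kappa ln_gt0 // ln3_gt1.
have lnK7 : 0 <= ln K7 by rewrite ln_ge0.
have K8_ge : 0 < K8 by rewrite /K8; have := divr_ge0 lnK7 (ltW kap); lra.
have K1p : 0 < K1 by lra.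
exists (2 * K1 * K8).
  by apply: mulr_gt0 K8_ge; apply: mulr_gt0 K1p.
move=> n m M eps n3 m0 mle Mle /andP[e0 e1].
pose y := eps^-1; have y1 : 1 <= y by rewrite invf_ge1 // ltW.
have ye : y * eps = 1 by rewrite mulVf // lt0r_neq0.
have y0 : 0 < y by apply: lt_le_trans y1.
have np : 0 < n%:R :> R by rewrite ltr0n; apply: leq_trans n3.
have n1 : 1 <= n%:R :> R by rewrite ler1n; apply: leq_trans n3.
pose lam : R := ln n%:R.
have lam3 : ln 3 <= lam by rewrite /lam ler_ln ?posrE ?ler_nat.
have lam1 : 1 <= lam by apply: le_trans lam3; exact: ltW ln3_gt1.
(* Exponents are linear in [W] and magnitudes polynomial in [Z] below. *)
pose W := lam * y.
have lam0 : 0 <= lam by apply: le_trans lam1.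
have lamp : 0 < lam by apply: lt_le_trans lam1.
have y0' : 0 <= y by exact: ltW.
have lamW : lam <= W by rewrite /W ler_peMr.
have yW : y <= W by rewrite /W ler_peMl.
have W1 : 1 <= W by exact: le_trans lam1 lamW.
have lnW : ln W = ln lam + ln (1 / eps).
  by rewrite /W lnM ?posrE // div1r.
have kapW : kappa <= ln W.
  have h : kappa <= ln lam.
    by rewrite /kappa ler_ln ?posrE // (lt_trans ltr01 ln3_gt1).
  by rewrite lnW div1r -/y -[leLHS]addr0; apply: lerD => //; exact: ln_ge0.
pose Z := n%:R * y.
have nZ : n%:R <= Z by rewrite /Z ler_peMr // ltW.
have yZ : y <= Z by rewrite /Z ler_peMl.
have Z1 : 1 <= Z by exact: le_trans n1 nZ.
have lnZ : ln Z <= 2 * W.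
  rewrite /Z lnM ?posrE // -/lam.
  rewrite mulr_natl mulr2n; apply: lerD => //.
  by apply: le_trans yW; apply: ltW; exact: ln_sublinear.
have y21 : 1 <= y ^+ 2 by rewrite expr_ge1 // ltW.
have q0 : 0 < q by rewrite /q mulr_gt0.
have [k /andP[k_lo k_hi]] : exists k : nat,
    1536 / delta * y ^+ 2 <= k%:R <= 1536 / delta * y ^+ 2 + 1.
  by apply: nat_ceil; rewrite !mulr_ge0 ?sqr_ge0.
have [N /andP[N_lo N_hi]] : exists N : nat,
    2 * (q * y) ^+ 2 <= N%:R <= 2 * (q * y) ^+ 2 + 1.
  by apply: nat_ceil; rewrite mulr_ge0 ?sqr_ge0.
have k1_hi : k.+1%:R <= K1 * y ^+ 2.
  rewrite -natr1; apply: le_trans (lerD k_hi (lexx _)) _.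
  have -> : K1 * y ^+ 2 = 1536 / delta * y ^+ 2 + 2 * y ^+ 2 by rewrite -mulrDl.
  by rewrite -[leLHS]addrA lerD2l -[leLHS](mulr1 2) ler_pM2l.
have k_gt0 : (0 < k)%N.
  rewrite -(ltr0n R); apply: lt_le_trans k_lo.
  by rewrite !mulr_gt0 ?exprn_gt0 // invr_gt0.
have kp : 0 < k%:R :> R by rewrite ltr0n.
have N_hi' : N%:R <= K2 * y ^+ 2.
  by apply: le_trans N_hi _; rewrite exprMn mulrA [leRHS]mulrDl mul1r lerD2l.
have qy2 : 2 <= q * y.
  have q2 : 2 <= q by rewrite /q -natrM ler_nat.
  by apply: le_trans q2 _; rewrite ler_peMr // ltW.
have N4 : (4 <= N)%N.
  rewrite -(ler_nat R); apply: le_trans N_lo; rewrite expr2.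
  have h : 2 * 2 <= (q * y) * (q * y) by rewrite ler_pM.
  by apply: le_trans (_ : 2 * (2 * 2) <= _); [by rewrite -!natrM ler_nat | rewrite ler_pM2l].
have Np : 0 < N%:R :> R by rewrite ltr0n (leq_trans _ N4).
pose V : R := 1 + 2 * N%:R * (n * (m * M))%:R.
have V1 : 1 <= V by rewrite /V lerDl !mulr_ge0 ?ler0n.
have Vp : 0 < V by apply: lt_le_trans V1.
have nNV : 1 <= n%:R * N%:R * V * y.
  have N1 : 1 <= N%:R :> R by rewrite ler1n (leq_trans _ N4).
  by do 3 ?apply: mulr_ege1.
have [T /andP[T_lo T_hi]] : exists T : nat,
    128 * (n%:R * N%:R * V * y) <= (2 ^ T)%:R <= 2 * (128 * (n%:R * N%:R * V * y)).
  by apply: pow2_ceil; apply: mulr_ege1 nNV; rewrite ler1n.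
have Tp : 0 < (2 ^ T)%:R :> R by rewrite ltr0n expn_gt0.
pose L : R := 4 * ln (N%:R * n%:R).
have Nn1 : 1 <= N%:R * n%:R :> R.
  by rewrite -natrM ler1n muln_gt0 (leq_trans _ N4) // (leq_trans _ n3).
have L0 : 0 <= L by rewrite /L mulr_ge0 // ln_ge0.
pose et : R := eps / (256 * (1 + L)).
have L1 : 0 < 1 + L by apply: lt_le_trans (ltr01) _; rewrite lerDl.
have B0 : 0 < 256 * (1 + L) by rewrite mulr_gt0.
have et0 : 0 < et by rewrite divr_gt0.
have etV : et^-1 = 256 * (1 + L) * y by rewrite /et invf_div /y.
have k1p : 0 < k.+1%:R :> R by rewrite ltr0n.
pose xb : R := 6 / delta * k.+1%:R * et ^- 2.
have et1 : 1 <= et^-1.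
  rewrite etV; apply: mulr_ege1 y1; apply: mulr_ege1; first by rewrite ler1n.
  by rewrite lerDl.
have xb6 : 6 <= xb.
  have h1 : 1 <= delta^-1 * k.+1%:R by apply: mulr_ege1 => //; rewrite ler1n.
  have h2 : 1 <= et ^- 2 by rewrite -exprVn expr_ge1 // (le_trans ler01 et1).
  by rewrite /xb -!mulrA ler_peMr // mulrA mulr_ege1.
have [b /andP[b_lo b_hi]] : exists b : nat, xb <= (2 ^ b)%:R <= 2 * xb.
  by apply: pow2_ceil; apply: le_trans xb6; rewrite ler1n.
have bp : 0 < (2 ^ b)%:R :> R by rewrite ltr0n expn_gt0.
have b1 : (1 <= b)%N.
  rewrite lt0n; apply: contraTneq b_lo => ->; rewrite -ltNge expn0.
  by apply: lt_le_trans xb6; rewrite ltr1n.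
pose U : R := (n * (m * M) * (N * 2 ^ T))%:R.
have U0 : 0 <= U by exact: ler0n.
pose xQ : R := 3 / delta * k.+1%:R * m%:R * U.
have xQ0 : 0 <= xQ by rewrite !mulr_ge0 ?ler0n.
have [Q /andP[Q_lo Q_hi]] : exists Q : nat, xQ + 1 <= (2 ^ Q)%:R <= 2 * (xQ + 1).
  by apply: pow2_ceil; rewrite lerDr.
have [l [l_lo l_hi]] : exists l : nat, (Q.+1 * (2 ^ b.+1).+1)%:R <= (2 ^ l)%:R :> R
    /\ (2 ^ l)%:R <= 2 * (Q.+1 * (2 ^ b.+1).+1)%:R :> R.
  have [|l /andP[]] := @pow2_ceil (Q.+1 * (2 ^ b.+1).+1)%:R; last by exists l.
  by rewrite ler1n.
exists k, N, T, b, Q, l; split => //; last 2 first.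
- by rewrite -(ler_nat R).
- have Z0 : 0 <= Z by apply: le_trans Z1.
  pose P : R := Z ^+ c.
  have P1 : 1 <= P by exact: exprn_ege1.
  have P0 : 0 <= P by apply: le_trans P1.
  have ncP : (n ^ c)%:R <= P by rewrite natrX lerXn2r ?nnegrE ?ler0n.
  have bnd (u : nat) : (u <= a * n ^ c)%N -> u%:R <= a%:R * P.
    move=> ule; apply: le_trans (_ : (a * n ^ c)%:R <= _); first by rewrite ler_nat.
    by rewrite natrM ler_wpM2l.
  have yy : y ^+ 2 <= Z ^+ 2 by rewrite lerXn2r ?nnegrE.
  have K10 : 0 <= K1 by exact: ltW.
  have K20 : 0 <= K2 by apply: le_trans K2_ge.
  have NZ : N%:R <= K2 * Z ^+ 2 by apply: le_trans N_hi' _; rewrite ler_wpM2l.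
  have kZ : k.+1%:R <= K1 * Z ^+ 2 by apply: le_trans k1_hi _; rewrite ler_wpM2l.
  have nmMB : (n * (m * M))%:R <= A2 * (Z * P ^+ 2).
    rewrite (_ : A2 * _ = Z * ((a%:R * P) * (a%:R * P))); last by rewrite /A2; ring.
    by rewrite !natrM; apply: ler_pM; rewrite ?mulr_ge0 //; apply: ler_pM; rewrite ?bnd.
  have z3 : 1 <= Z ^+ 3 * P ^+ 2 by apply: mulr_ege1; exact: exprn_ege1.
  have VB : V <= (1 + 2 * K2 * A2) * (Z ^+ 3 * P ^+ 2).
    rewrite mulrDl mul1r; apply: lerD => //.
    rewrite (_ : _ * (Z ^+ 3 * _) = 2 * (K2 * Z ^+ 2) * (A2 * (Z * P ^+ 2))); last by ring.
    by apply: ler_pM; rewrite ?mulr_ge0 // ler_wpM2l.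
  have TB : (2 ^ T)%:R <= KT * (Z ^+ 6 * P ^+ 2).
    apply: le_trans T_hi _.
    rewrite (_ : n%:R * N%:R * V * y = Z * N%:R * V); last by rewrite /Z; ring.
    rewrite (_ : KT * _ = 2 * (128 * (Z * (K2 * Z ^+ 2) *
      ((1 + 2 * K2 * A2) * (Z ^+ 3 * P ^+ 2))))); last by rewrite /KT; ring.
    rewrite ler_pM2l // ler_pM2l //; apply: ler_pM VB; rewrite ?mulr_ge0 ?(ltW Vp) //.
    by rewrite ler_wpM2l.
  have UB : U <= A2 * K2 * KT * (Z ^+ 9 * P ^+ 4).
    rewrite (_ : _ * (Z ^+ 9 * _) = A2 * (Z * P ^+ 2) *
      ((K2 * Z ^+ 2) * (KT * (Z ^+ 6 * P ^+ 2)))); last by ring.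
    by rewrite /U natrM (natrM _ N); apply: ler_pM; rewrite ?mulr_ge0 //; apply: ler_pM.
  have xQB : xQ <= K5 * (Z ^+ 11 * P ^+ 5).
    rewrite (_ : K5 * _ = 3 / delta * (K1 * Z ^+ 2) * (a%:R * P) *
      (A2 * K2 * KT * (Z ^+ 9 * P ^+ 4))); last by rewrite /K5; ring.
    have d3 : 0 <= 3 / delta by rewrite mulr_ge0.
    apply: ler_pM UB => //; first by rewrite mulr_ge0 // mulr_ge0.
    by apply: ler_pM; rewrite ?mulr_ge0 ?bnd // ler_wpM2l.
  have ZE : Z ^+ E = Z ^+ 11 * P ^+ 5 by rewrite /E /P -exprM -exprD addnC mulnC.
  have ZE1 : 1 <= Z ^+ E by exact: exprn_ege1.
  have QB : (2 ^ Q)%:R <= 2 * (K5 + 1) * Z ^+ E.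
    apply: le_trans Q_hi _; rewrite -mulrA ler_pM2l // mulrDl mul1r ZE.
    by apply: lerD => //; rewrite -ZE.
  have K51 : 1 <= 2 * (K5 + 1) by apply: mulr_ege1; rewrite ?ler1n // lerDr.
  have Qle := exponent_le K51 Z1 QB.
  have Q1 : Q.+1%:R <= K6 * W.
    rewrite -natr1 addrC /K6 [leRHS]mulrDl mul1r; apply: lerD => //.
    apply: le_trans Qle _; rewrite -[leRHS]mulrA ler_pM2l // [leRHS]mulrDl; apply: lerD.
      by rewrite ler_peMr.
    by rewrite (mulrC 2) -mulrA ler_wpM2l.
  have lnN : ln N%:R <= ln K2 + 2 * y.
    apply: le_trans (_ : ln (K2 * y ^+ 2) <= _).
      by rewrite ler_ln ?posrE // mulr_gt0 ?exprn_gt0 // (lt_le_trans ltr01).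
    rewrite lnM ?posrE ?exprn_gt0 ?(lt_le_trans ltr01 K2_ge) //.
    rewrite lnXn // lerD2l -[_ *+ 2]mulr_natl.
    by rewrite ler_pM2l // ltW // ln_sublinear.
  have LB : 1 + L <= (1 + K3) * W.
    rewrite [leRHS]mulrDl mul1r; apply: lerD => //.
    rewrite /L /K3 -[leRHS]mulrA ler_pM2l // lnM ?posrE // -/lam.
    rewrite (_ : _ * W = ln K2 * W + 2 * W + W); last by ring.
    apply: lerD => //; apply: le_trans lnN _; apply: lerD; first by rewrite ler_peMr.
    by rewrite ler_pM2l.
  have W0 : 0 <= W by apply: le_trans W1.
  have xbB : xb <= K4 * W ^+ 6.
    have d6 : 0 <= 6 / delta by rewrite mulr_ge0.
    rewrite /xb -exprVn etV (_ : K4 * _ = 6 / delta * (K1 * W ^+ 2) *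
      (256 * ((1 + K3) * W) * W) ^+ 2); last by rewrite /K4; ring.
    apply: ler_pM; rewrite ?sqr_ge0 ?mulr_ge0 //.
      rewrite ler_wpM2l //; apply: le_trans k1_hi _; rewrite ler_wpM2l //.
      by rewrite lerXn2r ?nnegrE.
    rewrite lerXn2r ?nnegrE //.
    - by rewrite mulr_ge0 // ltW.
    - by rewrite mulr_ge0 // mulr_ge0 // (le_trans (ltW L1)).
    by apply: ler_pM; rewrite ?(ltW B0) // ler_pM2l.
  have bB : (2 ^ b.+1).+1%:R <= 6 * (K4 * W ^+ 6).
    apply: le_trans (_ : 3 * (2 ^ b)%:R <= _).
      rewrite -[3]/((2 + 1)%:R) -natrM ler_nat mulnDl mul1n -expnS -addn1 leq_add2l.
      by rewrite expn_gt0.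
    rewrite (_ : 6 * _ = 3 * (2 * (K4 * W ^+ 6))); last by ring.
    by rewrite ler_pM2l // (le_trans b_hi) // ler_pM2l.
  have lB : (2 ^ l)%:R <= K7 * W ^+ 7.
    apply: le_trans l_hi _.
    rewrite (_ : K7 * _ = 2 * ((K6 * W) * (6 * (K4 * W ^+ 6)))); last by rewrite /K7; ring.
    by rewrite ler_pM2l // natrM; apply: ler_pM.
  have lle := exponent_le K7_ge W1 lB.
  have lK8 : l%:R <= K8 * ln W.
    apply: le_trans lle _; rewrite /K8 -[leRHS]mulrA ler_pM2l // [leRHS]mulrDl lerD2r.
    by rewrite -mulrA ler_peMr // mulrC ler_pdivlMr // mul1r.
  have lnW0 : 0 <= ln W by rewrite ln_ge0.
  rewrite -lnW !natrM (_ : _ * (_ * ln W) = 2 * ((K8 * ln W) * (K1 * y ^+ 2))); last first.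
    by rewrite /y exprVn div1r; ring.
  by rewrite ler_pM2l //; apply: ler_pM.
split.
- have s1 : Num.sqrt (2 / N%:R) <= (q * y)^-1.
    have qyp : 0 < q * y by rewrite mulr_gt0.
    rewrite -[leRHS]gtr0_norm ?invr_gt0 // -sqrtr_sqr ler_wsqrtr //.
    rewrite exprVn ler_pdivrMr // mulrC ler_pdivlMr ?exprn_gt0 //.
  have s2 : 208 * (q * y)^-1 = eps / 32.
    by rewrite invfM /y invrK /q; field.
  have s3 : 4 * n%:R * N%:R * V / (2 ^ T)%:R <= eps / 32.
    have e32 : 0 < eps / 32 by rewrite divr_gt0.
    rewrite ler_pdivrMr // -(ler_pdivrMl _ _ e32).
    have -> : (eps / 32)^-1 * (4 * n%:R * N%:R * V) = 128 * (n%:R * N%:R * V * y).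
      by rewrite /y; field; rewrite lt0r_neq0.
    exact: T_lo.
  have := ler_wpM2l (ler0n R 208) s1; rewrite s2 => s4.
  by rewrite (_ : eps / 16 = eps / 32 + eps / 32) ?lerD //; field.
- rewrite ler_pdivrMr ?mulr_gt0 ?exprn_gt0 //.
  have -> : (512 : R) = delta / 3 * (1536 / delta * y ^+ 2 * eps ^+ 2).
    by rewrite -[1536 / delta * _ * _]mulrA -exprMn ye expr1n mulr1; field; rewrite lt0r_neq0.
  by rewrite !ler_pM2l ?ler_pM2r ?exprn_gt0 ?divr_gt0.
- rewrite -/L -/et.
  have -> : k.+1%:R * (2 / (2 ^ b)%:R / et ^+ 2) = delta / 3 * (xb / (2 ^ b)%:R).
    by rewrite /xb; field; rewrite !lt0r_neq0 // exprn_gt0.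
  by rewrite ler_piMr ?divr_ge0 ?(ltW d0) // ler_pdivrMr // mul1r.
- rewrite -/U.
  have -> : k.+1%:R * (m%:R * (U / (2 ^ (b.+1 + Q))%:R))
    = delta / 3 * (xQ / (2 ^ (b.+1 + Q))%:R).
    by rewrite /xQ; field; rewrite !lt0r_neq0 // ltr0n expn_gt0.
  rewrite ler_piMr ?divr_ge0 ?(ltW d0) // ler_pdivrMr ?ltr0n ?expn_gt0 // mul1r.
  apply: le_trans (_ : (2 ^ Q)%:R <= _); first by apply: le_trans Q_lo; rewrite lerDl.
  by rewrite ler_nat leq_exp2l // leq_addl.
Qed.
End ParameterChoice.

Theorem theorem26 (R : realType) (a c : nat) (delta : R)
    (hdelta : 0 < delta < 1) :
  exists K : R,
    forall (n m M : nat) (e : rel 'I_m) (o : 'I_m) (eps : R),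
      (3 <= n)%N -> (m <= a * n ^ c)%N -> (M <= a * n ^ c)%N ->
      symmetric e -> irreflexive e -> (forall u v : 'I_m, connect e u v) ->
      0 < eps < 1 ->
      exists P : protocol R m n M,
        [/\ along_edges P e,
            self_delimiting P,
            (max_communication P e)%:R
              <= K * (1 / eps ^+ 2 * (ln (ln n%:R) + ln (1 / eps)))
          & forall X : inputs m n M, aggregate R X != 0 ->
              1 - delta <= success_prob P o eps X].
Proof.
have [K _ HK] := parameters_exist a c hdelta.
exists K => n m M e o eps n3 mle Mle _ _ conn heps.
have m0 : (0 < m)%N by exact: leq_ltn_trans (leq0n o) (ltn_ord o).
have [k [N [T [b [Q [l [[N4 k0 b1] [bias d1 d2 d3] lmsg lK]]]]]]] :=
  HK n m M eps n3 m0 mle Mle heps.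
have [par [d [epar dpar do0]]] := spanning_tree o conn.
pose Omega := ({ffun 'I_k -> {ffun 'I_n * 'I_N -> 'I_(2 ^ T)}} *
               {ffun option 'I_k -> {ffun 'I_m -> 'I_(2 ^ Q)}})%type.
pose Msg := {ffun option 'I_k -> 'I_Q.+1 * 'I_(2 ^ b.+1).+1}.
have cardOmega : #|{: Omega}| = (2 ^ (T * (n * N) * k + Q * m * k.+1))%N.
  by rewrite card_prod !card_ffun !card_prod card_option !card_ord -!expnM -expnD !mulnA.
have cardMsg : (#|{: Msg}| <= 2 ^ (l * k.+1))%N.
  by rewrite card_ffun card_prod card_option !card_ord expnM leq_exp2r.
have [P [eP sP cP oP]] := @tree_protocol_exists R n m M _ _ e o par d Omega Msg
  [ffun=> (ord0, ord0)] (fun v => @node n m M k N T b Q o par v)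
  (fun _ => @estimate R k N b Q) (@tree_msg n m M k N T b Q o par d)
  epar dpar do0 cardOmega cardMsg
  (fun v x w g h => @node_ext n m M k N T b Q o par v x w g h)
  (@tree_msgE n m M k N T b Q o par d dpar).
exists P; split => //.
  by apply: le_trans lK; rewrite ler_nat.
move=> X X0; rewrite oP.
exact: (entropy_protocol_correct dpar heps N4 k0 b1 X0 bias d1 d2 d3).
Qed.
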